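(* There are absolute constants $c$, $\alpha>0$ and $t_0$ such that for every integer $t\ge t_0$ the following holds. Let $\mathcal{R}_t$ be a set of $t$-boundaried planar graphs such that every equivalence class of $\equiv_{\mathrm{IS},t}$ that contains a planar graph of pathwidth at most $t+c$ contains some graph of $\mathcal{R}_t$. Then $\mathcal{R}_t$ contains a graph with at least $\alpha\log_2 M(t)$ vertices; moreover $\log_2 M(t)\ge 2^t/\sqrt{4t}$, so this is $\Omega(2^t/\sqrt{4t})$.
   Context: $M(t)$ is the $t$-th Dedekind number (number of monotone Boolean functions of $t$ variables). A $t$-boundaried graph is a finite simple undirected graph with an injective labeling of $t$ distinct boundary vertices by $1,\dots,t$; the gluing $G\oplus F$ is obtained from the disjoint union by identifying equally labeled boundary vertices and removing parallel edges. $\mathrm{opt}_{\mathrm{IS}}$ is the maximum size of an independent set. $G\equiv_{\mathrm{IS},t}H$ means there is $\Delta\in\mathbb{Z}$ with $\mathrm{opt}_{\mathrm{IS}}(G\oplus F)=\mathrm{opt}_{\mathrm{IS}}(H\oplus F)+\Delta$ for every $t$-boundaried graph $F$. The paper phrases the pathwidth bound as $t+\mathcal{O}(1)$ and the conclusion as ''a graph with $\Omega(\log M(t))\ge\Omega(2^t/\sqrt{4t})$ vertices''. *)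

(* Defs.v *)
From HB Require Import structures.
From mathcomp Require Import all_boot all_order all_algebra.
From mathcomp Require Import generic_quotient.
From mathcomp Require Import all_classical all_reals all_analysis.

Set Implicit Arguments.
Unset Strict Implicit.
Unset Printing Implicit Defensive.

Import Order.TTheory GRing.Theory Num.Theory numFieldNormedType.Exports.

Local Open Scope quotient_scope.

Record sgraph := SGraph {
  svertex :> finType;
  sedge : rel svertex;
  sedge_sym : symmetric sedge;
  sedge_irrefl : irreflexive sedge }.

Section Graphs.
Variable G : sgraph.

Definition edge_set : {set {set G}} :=
  [set [set p.1; p.2] | p : G * G & sedge p.1 p.2]%SET.

Definition independent (S : {set G}) : bool :=
  [forall x in S, forall y in S, ~~ sedge x y].

Definition opt_IS : nat := \max_(S : {set G} | independent S) #|S|.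

Definition path_decomposition (B : seq {set G}) : Prop :=
  [/\ forall v : G, exists2 X, X \in B & v \in X,
      forall x y : G, sedge x y -> exists2 X, X \in B & (x \in X) && (y \in X)
    & forall (v : G) i j k, i <= j -> j <= k -> k < size B ->
        v \in nth finset.set0 B i -> v \in nth finset.set0 B k ->
        v \in nth finset.set0 B j].

(* The truncated predecessor only matters for the graph without vertices,
   whose pathwidth is 0 here instead of -1. *)
Definition width (B : seq {set G}) : nat := (\max_(X <- B) #|X|).-1.

Lemma exists_path_decomposition :
  exists k, `[< exists2 B, path_decomposition B & width B = k >].
Proof.
exists (width [:: finset.setT]); apply/asboolP.
exists [:: finset.setT] => //; split=> [v|x y _|v i j k].
- by exists finset.setT; rewrite ?mem_seq1 ?eqxx ?(finset.in_setT v).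
- by exists finset.setT; rewrite ?mem_seq1 ?eqxx ?(finset.in_setT x) ?(finset.in_setT y).
- move=> ij jk k1 vi vk; suff -> : j = k by [].
  by move: jk k1 {vk}; case: k => // jk _; move: jk; rewrite leqn0 => /eqP.
Qed.

Definition pathwidth : nat := ex_minn exists_path_decomposition.

End Graphs.

Section Planarity.
Local Open Scope ring_scope.
Local Open Scope classical_set_scope.
Variables (R : realType) (G : sgraph).

(* Vertex v is drawn at p v; the edge e, a two-element set of vertices, is
   drawn as the arc that a e traces on [0, 1], in either direction. *)
Definition plane_drawing (p : G -> R * R) (a : {set G} -> R -> R * R) : Prop :=
  [/\ injective p,
      forall e : {set G}, e \in edge_set G ->
        [/\ {within `[0, 1], continuous (a e)},
            {in `[0, 1]%R &, injective (a e)}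
          & [set a e 0; a e 1] = [set p v | v in [set` e]]],
      forall (e : {set G}) (s : R) v, e \in edge_set G -> 0 < s < 1 -> a e s <> p v
    & forall (e e' : {set G}) (s s' : R), e \in edge_set G -> e' \in edge_set G -> e <> e' ->
        0 < s < 1 -> 0 < s' < 1 -> a e s <> a e' s'].

Definition planar : Prop := exists p a, plane_drawing p a.

End Planarity.

(* The label i + 1 of a t-boundaried graph is represented by i : 'I_t. *)
Record bgraph (t : nat) := BGraph {
  bgraph_graph :> sgraph;
  boundary : 'I_t -> bgraph_graph;
  boundary_inj : injective boundary }.

Section DisjointUnion.
Variables G F : sgraph.

Definition dunion_edge : rel (G + F) := fun u v =>
  match u, v with
  | inl x, inl y => sedge x y
  | inr x, inr y => sedge x y
  | _, _ => false
  end.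

Lemma dunion_edge_sym : symmetric dunion_edge.
Proof. by move=> [x|x] [y|y] //=; apply: sedge_sym. Qed.

Lemma dunion_edge_irrefl : irreflexive dunion_edge.
Proof. by move=> [x|x] /=; apply: sedge_irrefl. Qed.

End DisjointUnion.

Section Gluing.
Variables (t : nat) (G F : bgraph t).

Definition same_label (u v : G + F) : bool :=
  [exists i, (u == inl (boundary G i)) && (v == inr (boundary F i))].

Definition glue_rel : rel (G + F) := fun u v =>
  [|| u == v, same_label u v | same_label v u].

Lemma glue_rel_refl : reflexive glue_rel.
Proof. by move=> u; rewrite /glue_rel eqxx. Qed.

Lemma glue_rel_sym : symmetric glue_rel.
Proof. by move=> u v; rewrite /glue_rel eq_sym; congr (_ || _); rewrite orbC. Qed.

Lemma glue_rel_trans : transitive glue_rel.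
Proof.
move=> v u w; rewrite /glue_rel => /or3P[/eqP->//|uv|vu] /or3P[/eqP<-|vw|wv].
- by rewrite uv orbT.
- case/existsP: uv => i /andP[_ /eqP vE]; case/existsP: vw => j /andP[/eqP].
  by rewrite vE.
- case/existsP: uv => i /andP[/eqP-> /eqP vE].
  case/existsP: wv => j /andP[/eqP-> /eqP].
  by rewrite vE => -[/boundary_inj->]; rewrite eqxx.
- by rewrite vu !orbT.
- case/existsP: vu => i /andP[/eqP vE /eqP->].
  case/existsP: vw => j /andP[/eqP + /eqP->].
  by rewrite vE => -[/boundary_inj->]; rewrite eqxx.
- case/existsP: vu => i /andP[/eqP vE _]; case/existsP: wv => j /andP[_ /eqP].
  by rewrite vE.
Qed.

Canonical glue_equiv :=
  EquivRel glue_rel glue_rel_refl glue_rel_sym glue_rel_trans.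

Definition glue_vertex : finType := quot_type {eq_quot glue_equiv}.

Definition glue_pi : G + F -> glue_vertex := \pi_{eq_quot glue_equiv}.

Lemma glue_piP u v : reflect (glue_pi u = glue_pi v) (glue_rel u v).
Proof. exact: (@eqmodP _ glue_equiv). Qed.

Definition glue_edge : rel glue_vertex := fun C D =>
  [exists u, exists v, [&& glue_pi u == C, glue_pi v == D & dunion_edge u v]].

Lemma glue_edge_sym : symmetric glue_edge.
Proof.
suff sub C D : glue_edge C D -> glue_edge D C by move=> C D; apply/idP/idP; apply: sub.
case/existsP=> u /existsP[v /and3P[uC vD uv]].
by apply/existsP; exists v; apply/existsP; exists u; rewrite uC vD dunion_edge_sym.
Qed.

Lemma glue_edge_irrefl : irreflexive glue_edge.
Proof.
move=> C; apply/negbTE/negP => /existsP[u /existsP[v /and3P[/eqP uC /eqP vC uv]]].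
have : glue_rel u v by apply/glue_piP; rewrite uC vC.
case/or3P=> [/eqP vE|/existsP[i /andP[/eqP uE /eqP vE]]|
             /existsP[i /andP[/eqP vE /eqP uE]]]; move: uv; rewrite ?vE ?uE //.
by rewrite dunion_edge_irrefl.
Qed.

Definition glue : sgraph := SGraph glue_edge_sym glue_edge_irrefl.

End Gluing.

Definition equiv_IS (t : nat) (G H : bgraph t) : Prop :=
  exists Delta : int, forall F : bgraph t,
    ((opt_IS (glue G F))%:Z = (opt_IS (glue H F))%:Z + Delta)%R.

Definition monotone_bf (t : nat) (f : {ffun {ffun 'I_t -> bool} -> bool}) : bool :=
  [forall x : {ffun 'I_t -> bool}, forall y : {ffun 'I_t -> bool},
    [forall i, x i ==> y i] ==> (f x ==> f y)].

Definition dedekind (t : nat) : nat := #|[pred f | @monotone_bf t f]|.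

Definition log2 (R : realType) (x : R) : R := (ln x / ln 2)%R.

(* Main.v *)
(** Up to isomorphism there are only 2^O(n) planar graphs with n vertices,
    hence 2^O(n) n^t boundaried ones, while at least M(t) - 1 classes of the
    equivalence contain a planar graph of pathwidth t + O(1).

    Lower bound on the number of classes: for each monotone function f that is
    not constantly false, an evaluation grid with t rows (variables) and one
    column per clause of a CNF of f has, once the boundary vertices outside X are
    forbidden, an independent set meeting all cliques of a fixed clique partition
    iff f X = 1.  Gluing a pendant vertex onto each boundary vertex outside X
    forbids these vertices, so the class determines f.

    Upper bound on the number of planar graphs: a plane drawing yields no K5 minor,
    by a discrete van Kampen argument on finely sampled arcs.  Graphs without K5 minor have
    O(n) edges (Mader), and one can always pair up a constant fraction of the
    vertices into disjoint pairs of adjacent vertices or twins.  Identifying these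
    pairs gives a smaller graph without K5 minor from which the graph is recovered
    by O(n) bits. *)

From HB Require Import structures.
From Stdlib Require Import Btauto.
Require Import Defs.
From mathcomp Require Import all_boot all_order all_algebra.
From mathcomp Require Import zify ring lra.
From mathcomp Require boolp.

Set Implicit Arguments.
Unset Strict Implicit.
Unset Printing Implicit Defensive.

(** * Graphs without K5 minor are sparse *)

(** The encoding has to cost O(n) bits. Sparsity alone gives n^O(n) graphs, and since log n is of
    order t here, the final bound would lose a factor t. Boundary labels cost only O(t^2) bits,
    which the middle binomial coefficient dwarfs. Nothing bounds the pathwidth of the
    representatives, so all small planar graphs have to be counted. They are counted inside the
    class without K5 minor because that class visibly survives the identification of pairs; a
    drawing is used only to exclude K5, so neither faces nor Euler's formula nor the Jordan curve
    theorem occur. Equivalence preserves optima only up to an additive constant. Hence f X is read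
    off by comparing the optimum for X with the one for the full set, which is a usable reference
    only if f is true there; this is why the constantly false function is left out. *)

Section Minors.
Variable T : finType.
Implicit Types (e : rel T) (A B : {set T}).

Definition inside e A : rel T := [rel x y | [&& x \in A, y \in A & e x y]].

Definition connected_in e A : Prop := {in A &, forall x y, connect (inside e A) x y}.

Definition clique_minor e (r : nat) A : Prop :=
  exists b : nat -> {set T},
    (forall i, i < r -> [/\ b i \subset A, b i != set0 & connected_in e (b i)]) /\
    (forall i j, i < j < r -> [disjoint b i & b j] /\ exists x y, [/\ x \in b i, y \in b j & e x y]).

End Minors.

Section Density.
Variable T : finType.
Implicit Types (e : rel T) (A B : {set T}) (x y z u v : T).

Lemma connected_in1 e x : connected_in e [set x].
Proof. by move=> u v /set1P-> /set1P->; apply: connect0. Qed.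

Lemma clique_minorS e r A B : A \subset B -> clique_minor e r A -> clique_minor e r B.
Proof.
move=> AB [b [bP bb]]; exists b; split=> // i /bP[bA b0 cb]; split=> //.
exact: subset_trans bA AB.
Qed.

(** The preimages of the branch sets are branch sets again, since fibres are connected and edges
    lift. All three uses of minors below (edge contraction, absorbing a vertex of [S], identifying
    pairs) are instances. *)
Lemma clique_minor_lift (T' : finType) e (e' : rel T') r A (A' : {set T'}) (f : T -> T') : symmetric e ->
  (forall u : T', u \in A' -> [set x in A | f x == u] != set0 /\ connected_in e [set x in A | f x == u]) ->
  (forall u v : T', u \in A' -> v \in A' -> e' u v ->
     exists x y, [/\ x \in A, y \in A, f x = u, f y = v & e x y]) ->
  clique_minor e' r A' -> clique_minor e r A.
Proof.
move=> es fib edge [b [bP bb]].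
exists (fun i => [set x in A | f x \in b i]); split=> [i|i j] ir.
  have [/subsetP bA /set0Pn[u ub] cb] := bP _ ir; split.
  - by apply/subsetP => x; rewrite inE => /andP[].
  - have [/set0Pn[x +] _] := fib _ (bA _ ub); rewrite inE => /andP[xA /eqP fx].
    by apply/set0Pn; exists x; rewrite inE xA fx.
  have sub x y : x \in A -> y \in A -> f x = f y -> f x \in b i ->
      connect (inside e [set x in A | f x \in b i]) x y.
    move=> xA yA fxy fb; have [_ cf] := fib _ (bA _ fb).
    have cxy : connect (inside e [set z in A | f z == f x]) x y.
      by apply: cf; rewrite in_set ?xA ?yA ?fxy eqxx.
    move: cxy; apply: connect_sub => u' v'.
    rewrite /inside /= !inE => /and3P[/andP[u'A /eqP fu] /andP[v'A /eqP fv] uv].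
    by apply: connect1; rewrite /inside /= !inE u'A v'A uv fu fv fb.
  move=> x y; rewrite !inE => /andP[xA fx] /andP[yA fy].
  have /connectP[s] := cb _ _ fx fy.
  elim: s x xA fx => [|w s IHs] x xA fx /=.
    by move=> _ fyx; apply: sub.
  move=> /andP[/and3P[_ wb xw] ps] lw.
  have [x' [w' [x'A w'A fx' fw' xw']]] := edge _ _ (bA _ fx) (bA _ wb) xw.
  apply: connect_trans (sub x x' xA x'A (esym fx') fx) _.
  apply: (@connect_trans _ _ w').
    by apply: connect1; rewrite /inside /= !inE x'A w'A fx' fw' fx wb.
  by apply: IHs; rewrite ?fw'.
have [dj [u [v [ub vb uv]]]] := bb _ _ ir; split.
  apply/pred0P => x /=; rewrite !inE; case: (x \in A) => //=.
  by move/pred0P: dj => /(_ (f x)).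
case/andP: ir => ij jr; have ir := ltn_trans ij jr.
have [/subsetP bA _ _] := bP _ ir; have [/subsetP bA' _ _] := bP _ jr.
have [x [y [xA yA fx fy xy]]] := edge _ _ (bA _ ub) (bA' _ vb) uv.
by exists x, y; rewrite !inE xA yA fx fy.
Qed.

(** Twice the number of edges, as [e] is symmetric in all uses. *)
Definition arcs e A : nat := \sum_(u in A) \sum_(v in A) e u v.

Lemma arcs_gt0 e A : 0 < arcs e A -> exists x y, [/\ x \in A, y \in A & e x y].
Proof.
rewrite lt0n sum_nat_eq0 negb_forall => /existsP[x]; rewrite negb_imply => /andP[xA].
rewrite sum_nat_eq0 negb_forall => /existsP[y]; rewrite negb_imply eqb0 negbK => /andP[yA xy].
by exists x, y.
Qed.

(** Contraction of [y] onto [x] within the same type: [y] itself stays and has to be removed from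
    the vertex set separately. *)
Definition contract e x y : rel T :=
  fun u v => (u != v) && [|| e u v, (u == x) && e y v | (v == x) && e y u].

Lemma contract_sym e x y : symmetric e -> symmetric (contract e x y).
Proof.
by move=> es u v; rewrite /contract eq_sym es; congr (_ && (_ || _)); rewrite orbC.
Qed.

Lemma contract_irr e x y : irreflexive (contract e x y).
Proof. by move=> u; rewrite /contract eqxx. Qed.

Lemma clique_minor_contract e r A x y : symmetric e -> x \in A -> y \in A -> e x y ->
  clique_minor (contract e x y) r (A :\ y) -> clique_minor e r A.
Proof.
move=> es xA yA xy; apply: (@clique_minor_lift _ _ _ _ _ _ (fun z => if z == y then x else z)) => //.
  move=> u; rewrite in_setD1 => /andP[uy uA]; set F := [set z in A | _].
  have uF : u \in F by rewrite inE uA (negbTE uy) eqxx.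
  split; first by apply/set0Pn; exists u.
  have FE z : z \in F -> z = u \/ u = x /\ z = y.
    by rewrite inE => /andP[zA]; case: (z =P y) => [-> /= /eqP<-|_ /= /eqP->]; [right | left].
  move=> v w vF wF.
  have [vE|[ux vE]] := FE _ vF; have [wE|[ux' wE]] := FE _ wF; subst v w; rewrite ?connect0 //.
    by subst u; apply: connect1; rewrite /inside /= uF wF.
  by subst u; apply: connect1; rewrite /inside /= uF vF es.
move=> u v; rewrite !in_setD1 => /andP[uy uA] /andP[vy vA].
move=> /andP[_ /or3P[uv|/andP[/eqP-> yv]|/andP[/eqP-> yu]]].
- by exists u, v; rewrite (negbTE uy) (negbTE vy).
- by exists y, v; rewrite eqxx (negbTE vy).
- by exists u, y; rewrite eqxx (negbTE uy) es.
Qed.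

Definition common e A x y : nat := \sum_(v in A) (e x v && e y v).

(** Contraction destroys the edge [x y] and merges one pair of edges per common neighbour; each lost
    edge counts for two arcs. *)
Lemma arcs_contract e A x y : symmetric e -> irreflexive e -> x \in A -> y \in A -> e x y ->
  arcs e A = arcs (contract e x y) (A :\ y) + (common e A x y).*2 + 2.
Proof.
move=> es ei xA yA xy.
have xy' : x != y by apply: contraTneq xy => ->; rewrite ei.
(* [w] marks the neighbours that [x] gains; [S] below collects the arcs avoiding [y]. *)
pose w v : nat := [&& v != x, e y v & ~~ e x v].
have xA' : x \in A :\ y by rewrite !inE xy'.
pose S := \sum_(u in A :\ y) \sum_(v in A :\ y) (e u v : nat).
pose dy := \sum_(v in A :\ y) (e y v : nat).
have -> : arcs e A = S + dy.*2.
  rewrite /arcs (big_setD1 y) //= (big_setD1 y) //= ei add0n.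
  rewrite [X in _ + X = _](eq_bigr (fun u => e y u + \sum_(v in A :\ y) (e u v : nat))); last first.
    by move=> u _; rewrite (big_setD1 y) //= es.
  by rewrite big_split /= -/S -/dy; lia.
have -> : arcs (contract e x y) (A :\ y) = S + (\sum_(v in A :\ y) w v).*2.
  rewrite /arcs (eq_bigr (fun u => \sum_(v in A :\ y) (e u v : nat) +
      (\sum_(v in A :\ y) (u == x) * w v + \sum_(v in A :\ y) (v == x) * w u))); last first.
    move=> u uA; rewrite -!big_split /=; apply: eq_bigr => v vA.
    rewrite /contract /w; have [->|uv] /= := eqVneq u v.
      by rewrite ei; case: (v == x).
    case: (eqVneq u x) => [ux|ux] /=; case: (eqVneq v x) => [vx|vx] //=; rewrite ?orbF.
    - by move: uv; rewrite ux vx eqxx.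
    - by rewrite ux; case: (e x v); case: (e y v).
    - by rewrite vx es; case: (e x u); case: (e y u).
    - by rewrite ?muln0 ?mul0n ?addn0.
  rewrite big_split /= -/S; congr (_ + _); rewrite big_split /= -addnn; congr (_ + _).
    rewrite (big_setD1 x) //= eqxx [X in _ + X]big1 ?addn0.
      by apply: eq_bigr => v _; rewrite mul1n.
    by move=> u; rewrite !inE => /andP[/negbTE-> _]; rewrite big1.
  apply: eq_bigr => u _; rewrite (big_setD1 x) //= eqxx mul1n big1 ?addn0 //.
  by move=> v; rewrite !inE => /andP[/negbTE-> _].
suff -> : dy = \sum_(v in A :\ y) w v + common e A x y + 1 by lia.
have -> : common e A x y = \sum_(v in A :\ y) (e x v && e y v).
  by rewrite /common (big_setD1 y) //= ei andbF.
have {1}-> : 1 = \sum_(v in A :\ y) (v == x).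
  rewrite (big_setD1 x) //= eqxx big1 // => v.
  by rewrite !inE => /andP[/negbTE-> _].
rewrite -!big_split; apply: eq_bigr => v _ /=; rewrite /w.
have [->|_] /= := eqVneq v x; first by rewrite ei /= es xy.
by case: (e y v); case: (e x v).
Qed.

(* Mader: contract an edge with few common neighbours; if there is none, every
   vertex of a neighbourhood has many neighbours in it, so recurse there. *)
Lemma dense_clique_minor k e A : symmetric e -> irreflexive e -> A != set0 ->
  2 ^ k * #|A| <= arcs e A -> clique_minor e k.+2 A.
Proof.
elim: k e A => [|k IHk] e A es ei A0 dense.
  have [|x [y [xA yA xy]]] := @arcs_gt0 e A.
    by move: A0 dense; rewrite -card_gt0; lia.
  exists (fun i => if i == 0 then [set x] else [set y]); split=> [i|i j] ir.
    by case: i ir => [|[]] //= _; split; rewrite ?sub1set -?card_gt0 ?cards1 //; exact: connected_in1.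
  have [i0 j1] : i = 0 /\ j = 1 by lia.
  subst i j.
  split; last by exists x, y; rewrite !inE !eqxx.
  by rewrite /= disjoints1 inE; apply: contraTneq xy => ->; rewrite ei.
have [n] := ubnP #|A|; elim: n e A es ei A0 dense => // n IHn e A es ei A0 dense nA.
have D0 : 0 < arcs e A by move: A0 dense; rewrite -card_gt0 expnS; have := expn_gt0 2 k; lia.
(* Losing at most 2^(k+1) arcs is affordable, because one vertex disappears as well. Otherwise every
   edge has at least 2^k common neighbours. *)
case: (pickP (fun p : T * T =>
    [&& p.1 \in A, p.2 \in A, e p.1 p.2 & (common e A p.1 p.2).*2 + 2 <= 2 ^ k.+1])).
  move=> [x y] /= /and4P[xA yA xy few]; apply: (clique_minor_contract es xA yA xy).
  have cA := cardsD1 y A; rewrite yA in cA.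
  apply: IHn; [exact: contract_sym | exact: contract_irr | | | ].
  - by apply/set0Pn; exists x; rewrite !inE xA andbT; apply: contraTneq xy => ->; rewrite ei.
  - by move: dense; rewrite (arcs_contract es ei xA yA xy) cA mulnDr; lia.
  - by move: nA; rewrite cA; lia.
move=> many; have [x [y [xA yA xy]]] := arcs_gt0 D0.
pose B := [set v in A | e x v].
have BA : B \subset A by apply/subsetP => v; rewrite inE => /andP[].
have [||b [bP bb]] := IHk e B es ei.
- by apply/set0Pn; exists y; rewrite inE yA.
- rewrite mulnC -sum_nat_const; apply: leq_sum => u; rewrite inE => /andP[uA xu].
  have := many (x, u); rewrite /= xA uA xu /= => /negbT; rewrite -ltnNge expnS.
  suff -> : common e A x u = \sum_(v in B) (e u v : nat) by lia.
  rewrite /common big_mkcond [RHS]big_mkcond; apply: eq_bigr => v _.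
  by rewrite inE; case: (v \in A); case: (e x v).
exists (fun i => if i == k.+2 then [set x] else b i); split=> [i|i j] ir.
  rewrite /=; case: (i =P k.+2) => [_|ni]; first by split; rewrite ?sub1set -?card_gt0 ?cards1 //; exact: connected_in1.
  have [|bB b0 cb] := bP i; first by lia.
  by split=> //; exact: subset_trans bB BA.
have [ni i2] : i != k.+2 /\ i < k.+2 by lia.
have [/subsetP bB /set0Pn[z zb] _] := bP i i2.
rewrite /= (negbTE ni); case: (j =P k.+2) => [jk|nj]; last by apply: bb; lia.
split; first by rewrite disjoint_sym disjoints1; apply/negP => /bB; rewrite inE ei andbF.
by exists z, x; rewrite zb inE eqxx es; split=> //; have := bB _ zb; rewrite inE => /andP[].
Qed.

Lemma K5_free_sparse e A : symmetric e -> irreflexive e -> ~ clique_minor e 5 A ->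
  arcs e A <= 8 * #|A|.
Proof.
move=> es ei free; have [->|A0] := eqVneq A set0; first by rewrite /arcs big_set0.
by rewrite leqNgt; apply/negP => /ltnW H; apply: free; apply: (@dense_clique_minor 3).
Qed.

End Density.

(** * Counting graphs without K5 minor *)

Section Cliques.
Variable T : finType.
Implicit Types (e : rel T) (A B S C : {set T}) (x y z u v : T).

Definition clique e C : bool := [forall x in C, forall y in C, (x != y) ==> e x y].

(** By sparsity some vertex has at most 8 neighbours. The cliques through it correspond to subsets
    of its neighbourhood, at most 2^8 = 256; the others survive its deletion. *)
Lemma card_cliques e A : symmetric e -> irreflexive e -> ~ clique_minor e 5 A ->
  #|[set C : {set T} | (C \subset A) && clique e C]| <= 256 * #|A| + 1.
Proof.
move=> es ei; have [n] := ubnP #|A|; elim: n A => // n IHn A nA free.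
have [A0|[w wA]] := set_0Vmem A.
  rewrite -(cards1 (set0 : {set T})) (leq_trans _ (leq_addl _ _)) //; apply: subset_leq_card.
  by apply/subsetP => C; rewrite !inE A0 subset0 => /andP[].
have [v vA deg] : exists2 v, v \in A & \sum_(u in A) (e v u : nat) <= 8.
  apply/exists_inP; apply: contraT; rewrite negb_exists_in => /forall_inP H.
  have := K5_free_sparse es ei free; rewrite leqNgt -ltnS -addn1 => /negP[].
  have : \sum_(v in A) 9 <= arcs e A.
    by apply: leq_sum => v vA; have := H v vA; rewrite -ltnNge.
  have : 0 < #|A| by apply/card_gt0P; exists w.
  by rewrite sum_nat_const; lia.
pose N := [set u in A | e v u].
have cN : #|N| <= 8.
  rewrite (leq_trans _ deg) // -sum1_card big_mkcond [X in _ <= X]big_mkcond /=.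
  by apply: leq_sum => u _; rewrite inE; case: (u \in A); case: (e v u).
have cA := cardsD1 v A; rewrite vA in cA.
pose Q B := [set C : {set T} | (C \subset B) && clique e C].
have QA : Q A \subset Q (A :\ v) :|: [set v |: C | C in powerset N].
  apply/subsetP => C; rewrite !inE => /andP[CA cC]; rewrite cC andbT.
  have [vC|vC] := boolP (v \in C); last by rewrite subsetD1 CA vC.
  apply/orP; right; apply/imsetP; exists (C :\ v); last by rewrite setD1K.
  rewrite inE; apply/subsetP => u; rewrite !inE => /andP[uv uC]; rewrite (subsetP CA) //=.
  by move/forall_inP: cC => /(_ v vC)/forall_inP/(_ u uC); rewrite eq_sym uv.
have free' : ~ clique_minor e 5 (A :\ v).
  by move=> m; apply: free; apply: clique_minorS m; exact: subD1set.
have := IHn (A :\ v) _ free'; rewrite cA in nA *; move=> /(_ nA) IH.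
apply: leq_trans (subset_leq_card QA) _; apply: leq_trans (leq_card_setU _ _) _.
have : #|[set v |: C | C in powerset N]| <= 2 ^ 8.
  apply: leq_trans (leq_imset_card _ _) _; rewrite card_powerset; exact: leq_pexp2l.
rewrite -/(Q _) in IH; have -> : 2 ^ 8 = 256 by [].
lia.
Qed.

(* As long as some vertex of [S] has two nonadjacent neighbours in [B], contracting
   it onto one of them adds an edge to [B]; afterwards the neighbourhoods of the
   vertices of [S] are cliques of the sparse graph on [B]. *)
Lemma distinct_neighbourhoods e B S : symmetric e -> irreflexive e ->
    [disjoint S & B] -> {in S & S, forall u v, ~~ e u v} ->
    {in S &, injective (fun v => [set w in B | e v w])} ->
    ~ clique_minor e 5 (B :|: S) ->
  2 * #|S| + arcs e B <= 520 * #|B| + 2.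
Proof.
have [n] := ubnP #|S|; elim: n e S => // n IHn e S nS es ei dj ind nbinj free.
have freeB : ~ clique_minor e 5 B.
  by move=> m; apply: free; apply: clique_minorS m; exact: subsetUl.
(* If all neighbourhoods are cliques, [S] has at most 256 #|B| + 1 elements, and 520 = 2 * 256 + 8
   also pays for the arcs of [B]. *)
have [all_cliques|] := boolP [forall v in S, clique e [set w in B | e v w]].
  have := card_cliques es ei freeB; have := K5_free_sparse es ei freeB.
  have : #|[set [set w in B | e v w] | v in S]| = #|S| by apply: card_in_imset.
  have : [set [set w in B | e v w] | v in S] \subset
         [set C : {set T} | (C \subset B) && clique e C].
    apply/subsetP => _ /imsetP[v vS ->]; rewrite inE (forall_inP all_cliques) // andbT.
    by apply/subsetP => w; rewrite inE => /andP[].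
  by move=> /subset_leq_card; lia.
rewrite negb_forall_in => /exists_inP[v vS]; rewrite negb_forall_in => /exists_inP[x].
rewrite inE => /andP[xB vx]; rewrite negb_forall_in => /exists_inP[y].
rewrite inE negb_imply => /andP[yB vy] /andP[xy nxy].
(* Of the edges created by contracting [v] onto [x] only [x y] is kept, so the neighbourhoods of the
   rest of [S] do not change. One vertex of [S] is traded for two arcs of [B]. *)
pose e' : rel T := fun u w => [|| e u w, (u == x) && (w == y) | (u == y) && (w == x)].
have notS z : z \in B -> z \notin S.
  by move=> zB; apply/negP => zS; move/pred0P: dj => /(_ z); rewrite /= zS zB.
have es' : symmetric e'.
  by move=> u w; rewrite /e' es; congr (_ || _); rewrite orbC; congr (_ || _); rewrite andbC.
have ei' : irreflexive e'.
  move=> u; rewrite /e' ei /=; apply/negbTE; rewrite negb_or !negb_and.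
  by have [->|ux] := eqVneq u x; rewrite ?(negbTE xy) ?orbT.
have Se u w : u \in S -> e' u w = e u w.
  move=> uS.
  have neq z : z \in B -> (u == z) = false.
    by move=> zB; apply/negbTE; apply: contraTneq uS => ->; exact: notS.
  by rewrite /e' !neq ?orbF.
have cS := cardsD1 v S; rewrite vS in cS.
have := IHn e' (S :\ v) _ es' ei' _ _ _ _.
have sS : S :\ v \subset S by exact: subD1set.
have arcs2 : arcs e B + 2 <= arcs e' B.
  have one a b : a \in B -> b \in B -> \sum_(u in B) \sum_(w in B) ((u == a) && (w == b) : nat) = 1.
    move=> aB bB; rewrite (big_setD1 a) //= (big_setD1 b) //= !eqxx /= !big1 //.
      by move=> u; rewrite !inE => /andP[/negbTE-> _]; rewrite big1.
    by move=> w; rewrite !inE => /andP[/negbTE-> _].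
  rewrite -[2]/(1 + 1) -[X in _ + (X + _)](one x y xB yB) -[X in _ + (_ + X)](one y x yB xB).
  rewrite /arcs -!big_split /=.
  apply: leq_sum => u _; rewrite -!big_split /=; apply: leq_sum => w _; rewrite /e'.
  have [->|ux] := eqVneq u x; have [->|wx] := eqVneq w x => /=; rewrite ?ei ?andbF ?(negbTE xy) //=.
  - by have [->|] := eqVneq w y; rewrite ?(negbTE nxy) ?orbF ?addn0.
  - by have [->|] := eqVneq u y; rewrite ?(es y x) ?(negbTE nxy) ?orbF ?addn0.
  - by rewrite ?andbF ?orbF ?addn0.
suff H : ~ clique_minor e' 5 (B :|: S :\ v).
  move=> /(_ _ _ _ _ H); rewrite cS; have := nS; rewrite cS => nS'.
  move=> IH; have {}IH := IH _ _ _ _; suff : 2 * #|S :\ v| + arcs e' B <= 520 * #|B| + 2 by lia.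
  apply: IH; first by lia.
  - by apply: disjointWl sS dj.
  - by move=> u w /(subsetP sS) uS /(subsetP sS) wS; rewrite Se // ind.
  - move=> u w /(subsetP sS) uS /(subsetP sS) wS; under eq_finset do rewrite Se //.
    by under [RHS]eq_finset do rewrite Se //; apply: nbinj.
move=> m; apply: free; move: m.
apply: (@clique_minor_lift _ _ _ _ _ _ _ (fun z => if z == v then x else z)) => //.
  move=> u uBS; set F := [set z in _ | _].
  have uv : u != v.
    apply: contraTneq uBS => ->; rewrite !inE eqxx /= orbF.
    by apply/negP => vB; have := notS _ vB; rewrite vS.
  have uBS' : u \in B :|: S by move: uBS; rewrite !inE => /orP[->//|/andP[_ ->]]; rewrite orbT.
  have uF : u \in F by rewrite inE uBS' (negbTE uv) eqxx.
  split; first by apply/set0Pn; exists u.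
  have FE z : z \in F -> z = u \/ u = x /\ z = v.
    by rewrite inE => /andP[zA]; case: (z =P v) => [-> /= /eqP<-|_ /= /eqP->]; [right | left].
  move=> a b aF bF.
  have [aE|[ux aE]] := FE _ aF; have [bE|[ux' bE]] := FE _ bF; subst a b; rewrite ?connect0 //.
    by subst u; apply: connect1; rewrite /inside /= uF bF es.
  by subst u; apply: connect1; rewrite /inside /= uF aF.
have ne u : u \in B :|: S :\ v -> u != v.
  apply: contraTneq => ->; rewrite !inE eqxx /= orbF.
  by apply/negP => vB; have := notS _ vB; rewrite vS.
have inBS u : u \in B :|: S :\ v -> u \in B :|: S.
  by rewrite !inE => /orP[->//|/andP[_ ->]]; rewrite orbT.
have vBS : v \in B :|: S by rewrite inE vS orbT.
move=> u w uBS wBS /or3P[uw|/andP[/eqP ux /eqP wy]|/andP[/eqP uy /eqP wx]].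
- by exists u, w; rewrite (negbTE (ne _ uBS)) (negbTE (ne _ wBS)) !inBS.
- by exists v, w; split; rewrite /= ?eqxx /= ?(negbTE (ne _ wBS)) ?vBS ?(inBS _ wBS) ?ux ?wy.
- by exists u, v; split; rewrite /= ?eqxx /= ?(negbTE (ne _ uBS)) ?vBS ?(inBS _ uBS) ?wx ?uy ?(es y).
Qed.

End Cliques.

(** * Pairs of adjacent vertices or twins, and the quotient by them *)

Section Pairing.
Variables (T : finType) (e : rel T).
Hypotheses (es : symmetric e) (ei : irreflexive e).
Implicit Types (f : {ffun T -> T}) (x y z : T).

Definition twin x y : bool := [forall z, e x z == e y z].

Definition moved f : {set T} := [set x | f x != x].

(** A family of disjoint pairs is encoded as an idempotent map that sends one member of each pair to
    the other. Its fixed points serve as the vertices of the quotient, and #|moved f| is the number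
    of pairs. *)
Definition pairing f : bool :=
  [&& [forall x, f (f x) == f x],
      [forall x in moved f, e x (f x) || twin x (f x)]
    & [forall x in moved f, forall y in moved f, (f x == f y) ==> (x == y)]].

Lemma pairingP f : reflect
  [/\ forall x, f (f x) = f x,
      forall x, f x != x -> e x (f x) || twin x (f x)
    & forall x y, f x != x -> f y != y -> f x = f y -> x = y] (pairing f).
Proof.
apply: (iffP and3P) => -[H1 H2 H3]; split.
- by move=> x; apply/eqP; move/forallP: H1.
- by move=> x fx; apply: (forall_inP H2); rewrite inE.
- move=> x y fx fy fxy; apply/eqP; apply: (implyP (forall_inP (forall_inP H3 x _) y _)); rewrite ?inE //.
  by rewrite fxy.
- by apply/forallP => x; rewrite H1.
- by apply/forall_inP => x; rewrite inE; exact: H2.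
- apply/forall_inP => x; rewrite inE => fx; apply/forall_inP => y; rewrite inE => fy.
  by apply/implyP => /eqP fxy; rewrite (H3 x y).
Qed.

Lemma pairing_id : pairing [ffun x => x].
Proof. by apply/pairingP; split=> [x|x|x y]; rewrite !ffunE ?eqxx. Qed.

(** Serves to make the size of the quotient a function of the size of the graph alone. *)
Lemma pairing_restrict f q : pairing f -> q <= #|moved f| ->
  exists2 f', pairing f' & #|moved f'| = q.
Proof.
move=> pf; move: {2}(#|moved f| - q) (erefl (#|moved f| - q)) => k.
elim: k f pf => [|k IHk] f pf kE qf; first by exists f => //; lia.
have /card_gt0P[x] : 0 < #|moved f| by lia.
move=> xm; pose f' := [ffun y => if y == x then x else f y].
have [H1 H2 H3] := pairingP _ pf.
have mE : moved f' = moved f :\ x.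
  by apply/setP => y; rewrite !inE ffunE; case: (eqVneq y x) => [->|]; rewrite ?eqxx.
have cm := cardsD1 x (moved f); rewrite xm -mE in cm.
apply: (IHk f'); [ | lia | lia].
apply/pairingP; split=> [y|y|y z]; rewrite !ffunE.
- have [yx|yx] := eqVneq y x; first by rewrite eqxx.
  by rewrite H1; case: eqP.
- by case: (eqVneq y x) => [->|_]; rewrite ?eqxx // => /H2.
- case: (eqVneq y x) => [->|_]; rewrite ?eqxx //; case: (eqVneq z x) => [->|_]; rewrite ?eqxx //.
  exact: H3.
Qed.

(** In a maximal pairing the unpaired vertices are pairwise nonadjacent and not twins, so their
    neighbourhoods among the paired ones differ. This gives at most 520 unpaired and 2 paired
    vertices per pair, up to the additive 1. *)
Lemma large_pairing : ~ clique_minor e 5 [set: T] ->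
  exists2 f, pairing f & #|T| <= 522 * #|moved f| + 1.
Proof.
move=> free.
case: (arg_maxnP (fun f => #|moved f|) pairing_id) => f pf fmax; exists f => //.
have [H1 H2 H3] := pairingP _ pf.
pose S := [set x | (f x == x) && [forall y in moved f, f y != x]].
have SP x : x \in S -> f x = x /\ forall y, f y = x -> y = x.
  rewrite inE => /andP[/eqP fx /forall_inP H]; split=> // y fy; apply/eqP; apply: contraT => yx.
  by have := H y; rewrite inE fy eq_sym yx eqxx => /(_ isT).
have maxS x y : x \in S -> y \in S -> x != y -> ~~ (e x y || twin x y).
  move=> xS yS xy; apply/negP => rxy.
  have [fx xim] := SP _ xS; have [fy yim] := SP _ yS.
  pose f' := [ffun z => if z == x then y else f z].
  suff pf' : pairing f'.
    have : #|moved f'| = #|moved f|.+1.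
      suff -> : moved f' = x |: moved f by rewrite cardsU1 inE fx eqxx.
      apply/setP => z; rewrite !inE ffunE; have [->|] //= := eqVneq z x; by rewrite eq_sym.
    by have := fmax f' pf'; move=> /= + E; rewrite E ltnn.
  apply/pairingP; split=> [z|z|z w]; rewrite !ffunE.
  - have [zx|zx] := eqVneq z x; first by rewrite eq_sym (negbTE xy).
    by rewrite H1; case: eqP => // /xim zx'; rewrite zx' eqxx in zx.
  - by have [->|_] := eqVneq z x; [rewrite rxy | exact: H2].
  - have [->|zx] := eqVneq z x; have [->|wx] := eqVneq w x => //.
    + by move=> _ fw /esym/yim wy; move: fw; rewrite wy fy eqxx.
    + by move=> fz _ /yim zy; move: fz; rewrite zy fy eqxx.
    + exact: H3.
have ind : {in S & S, forall u v, ~~ e u v}.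
  move=> u v uS vS; have [->|uv] := eqVneq u v; first by rewrite ei.
  by have := maxS _ _ uS vS uv; rewrite negb_or => /andP[].
have dj : [disjoint S & ~: S] by rewrite disjoints_subset setCK.
have ninj : {in S &, injective (fun v => [set w in ~: S | e v w])}.
  move=> u v uS vS E; apply/eqP; apply: contraT => uv; have := maxS _ _ uS vS uv.
  rewrite negb_or => /andP[_ /forallPn[z]] /eqP[].
  have [zS|zS] := boolP (z \in S); first by rewrite (negbTE (ind _ _ uS zS)) (negbTE (ind _ _ vS zS)).
  by move/setP: E => /(_ z); rewrite !inE; rewrite -in_setC in zS; move: zS; rewrite !inE => ->.
have cover : ~: S :|: S = [set: T] by rewrite setUC setUCr.
have := @distinct_neighbourhoods _ e (~: S) S es ei dj ind ninj; rewrite cover => /(_ free).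
have cB : #|~: S| <= 2 * #|moved f|.
  have : ~: S \subset moved f :|: [set f x | x in moved f].
    apply/subsetP => x; rewrite !inE negb_and => /orP[->//|/forall_inPn[y ym]].
    by rewrite negbK => /eqP <-; rewrite imset_f ?orbT.
  move=> /subset_leq_card H; apply: leq_trans H _; apply: leq_trans (leq_card_setU _ _) _.
  by rewrite mul2n -addnn leq_add2l; exact: leq_imset_card.
have := cardsC S; lia.
Qed.

Section Quotient.
Variable f : {ffun T -> T}.
Hypothesis pf : pairing f.

Local Notation fixpoint := {x : T | f x == x}.

Fact pairing_fix x : f (f x) == f x.
Proof. by have [-> _ _] := pairingP _ pf. Qed.

Definition class x : fixpoint := exist _ (f x) (pairing_fix x).

Definition quotient_edge : rel fixpoint := fun u v =>
  (u != v) && [exists x, exists y, [&& class x == u, class y == v & e x y]].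

Lemma quotient_edge_sym : symmetric quotient_edge.
Proof.
suff sub u v : quotient_edge u v -> quotient_edge v u by move=> u v; apply/idP/idP; apply: sub.
rewrite /quotient_edge eq_sym => /andP[-> /existsP[x /existsP[y /and3P[xu yv xy]]]] /=.
by apply/existsP; exists y; apply/existsP; exists x; rewrite xu yv es.
Qed.

Lemma quotient_edge_irr : irreflexive quotient_edge.
Proof. by move=> u; rewrite /quotient_edge eqxx. Qed.

Lemma class_val u : class (val u) = u.
Proof. by apply: val_inj; apply/eqP; exact: (valP u). Qed.

(** An adjacent pair is contracted. Of a nonadjacent pair of twins the moved one is deleted, and its
    partner takes over its edges; [A] is what remains after these deletions. *)
Lemma quotient_K5_free : ~ clique_minor e 5 [set: T] -> ~ clique_minor quotient_edge 5 [set: fixpoint].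
Proof.
have [H1 H2 H3] := pairingP _ pf.
move=> free minor; apply: free; pose A := [set x | (f x == x) || e x (f x)].
apply: (@clique_minorS _ _ _ A); first exact: subsetT.
apply: (@clique_minor_lift _ _ _ _ _ _ _ class es _ _ minor) => [u _|u v _ _].
  have uF : val u \in [set x in A | class x == u] by rewrite !inE class_val (eqP (valP u)) !eqxx.
  split; first by apply/set0Pn; exists (val u).
  have star x : x \in [set x in A | class x == u] ->
      x = val u \/ inside e [set x in A | class x == u] x (val u).
    move=> xF; move: (xF); rewrite !inE => /andP[xA /eqP cx].
    have fx : f x = val u by rewrite -cx.
    case/orP: xA => [/eqP fxx|xe]; first by left; rewrite -fx.
    by right; rewrite /inside /= xF uF -fx.
  move=> x y xF yF; apply: (@connect_trans _ _ (val u)).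
    by case: (star x xF) => [->|H]; [exact: connect0 | exact: connect1].
  case: (star y yF) => [->|H]; first exact: connect0.
  by apply: connect1; move: H; rewrite /inside /= es => /and3P[-> -> ->].
move=> /andP[_ /existsP[x /existsP[y /and3P[/eqP xu /eqP yv xy]]]].
have rep z : exists z', [/\ z' \in A, class z' = class z & forall w, e z w -> e z' w].
  have [zA|] := boolP (z \in A); first by exists z.
  rewrite inE negb_or => /andP[fz ez]; exists (f z); split.
  - by rewrite inE H1 eqxx.
  - by apply: val_inj; rewrite /= H1.
  - move=> w; have := H2 z fz; rewrite (negbTE ez) /= => /forallP/(_ w)/eqP->; exact.
have [x' [x'A cx' ex']] := rep x; have [y' [y'A cy' ey']] := rep y.
exists x', y'; split=> //; rewrite ?cx' ?cy' //.
by rewrite es; apply: ey'; rewrite es; apply: ex'.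
Qed.

Lemma card_fixpoint : #|{: fixpoint}| = #|T| - #|moved f|.
Proof.
rewrite card_sig -(cardC [pred x | f x == x]) (_ : #|moved f| = #|[predC [pred x | f x == x]]|) ?addnK //.
by apply: eq_card => x; rewrite !inE.
Qed.

Lemma class_pair_inj : injective (fun x => (class x, f x != x)).
Proof.
have [_ _ H3] := pairingP _ pf.
move=> x y E; have fxy : f x = f y := congr1 (fun p => val p.1) E.
have : (f x != x) = (f y != y) := congr1 snd E.
case: (eqVneq (f x) x) => [fx|fx] /=; case: (eqVneq (f y) y) => [fy|fy] //= _; last exact: H3.
by rewrite -fx -fy.
Qed.

End Quotient.
End Pairing.

Section Decode.
Variables (m n : nat) (g : rel 'I_m).

Definition lex_edges : {set ('I_m * bool) * ('I_m * bool)} :=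
  [set p | (p.1.1 == p.2.1) || g p.1.1 p.2.1].

(** Vertices are numbered by their position in [enum U], arcs by their position in [enum lex_edges].
    With positions instead of arcs the type of [K] does not depend on [g]. *)
Definition decode (U : {set 'I_m * bool}) (K : {set 'I_(36 * m)}) : rel 'I_n := fun a b =>
  [exists u in U, exists v in U,
    [&& index u (enum U) == a, index v (enum U) == b &
      [exists k in K, index (u, v) (enum lex_edges) == k]]].

(** Each vertex and each arc of the quotient gives 4 pairs: 4 m + 4 * 8 m. *)
Lemma card_lex_edges : \sum_a \sum_b (g a b : nat) <= 8 * m -> #|lex_edges| <= 36 * m.
Proof.
move=> sparse.
have -> : #|lex_edges| = \sum_(u : 'I_m * bool) \sum_(v : 'I_m * bool) ((u.1 == v.1) || g u.1 v.1).
  rewrite pair_bigA /= -sum1_card big_mkcond /=; apply: eq_bigr => p _.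
  by rewrite inE; case: (_ || _).
have bool2 (F : 'I_m -> nat) : \sum_(u : 'I_m * bool) F u.1 = 2 * \sum_a F a.
  rewrite (eq_bigr (fun u => (fun a (c : bool) => F a) u.1 u.2)) //.
  rewrite -(pair_bigA _ (fun a (c : bool) => F a)) big_distrr /=; apply: eq_bigr => a _.
  by rewrite sum_nat_const card_bool.
apply: (@leq_trans (\sum_(u : 'I_m * bool) 2 * \sum_b ((u.1 == b) + g u.1 b))).
  apply: leq_sum => u _; rewrite -bool2; apply: leq_sum => v _ /=.
  by case: (_ == _); case: (g _ _).
rewrite (bool2 (fun a => 2 * \sum_b ((a == b) + g a b))) -big_distrr /=.
under eq_bigr do rewrite big_split /=.
rewrite big_split /= (_ : \sum_a \sum_b (a == b) = m); first by move: sparse; set s := \sum_(a < m) _; lia.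
rewrite (eq_bigr (fun=> 1)) ?sum_nat_const ?card_ord ?muln1 // => a _.
by rewrite (bigD1 a) //= eqxx big1 // => b /negbTE; rewrite eq_sym => ->.
Qed.

End Decode.

(* A graph is recovered from its quotient by a pairing, the set of pairs
   (class, moved?) that occur, and its arcs as a subset of the lexicographic
   product of the quotient with two isolated vertices. *)
Lemma K5_free_codes n : exists (I : finType) (g : I -> rel 'I_n),
  #|I| <= 2 ^ (38 * 522 * n) /\
  forall (T : finType) (e : rel T), symmetric e -> irreflexive e ->
    ~ clique_minor e 5 [set: T] -> #|T| = n ->
    exists i (h : T -> 'I_n), injective h /\ forall x y, e x y = g i (h x) (h y).
Proof.
elim/ltn_ind: n => n IHn.
have [n1|n1] := leqP n 1.
  exists unit, (fun _ => [rel _ _ | false]); split; first by rewrite card_unit expn_gt0.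
  move=> T e es ei free Tn.
  have hP (x : T) : 0 < n by rewrite -Tn; apply/card_gt0P; exists x.
  exists tt, (fun x => Ordinal (hP x)).
  have T1 (x y : T) : x = y by apply: (@fintype_le1P T _); rewrite Tn.
  by split=> [x y _|x y]; rewrite (T1 x y) //= ei.
(* [q] is (n - 1) / 522 rounded up, the number of pairs that [large_pairing] guarantees. *)
pose q := (n + 520) %/ 522; pose m := n - q.
have qn : n <= 522 * q + 1 by rewrite /q; lia.
have q0 : 0 < q by rewrite /q; lia.
have qln : q <= n by rewrite /q; lia.
have mn : m < n by rewrite /m; lia.
have [I [g [cI Hg]]] := IHn m mn.
exists (I * {set 'I_m * bool} * {set 'I_(36 * m)})%type, (fun c => @decode m n (g c.1.1) c.1.2 c.2).
split.
  have card_set (T : finType) : #|{set T}| = 2 ^ #|T|.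
    by have := card_powerset [set: T]; rewrite powersetT !cardsT.
  rewrite !card_prod !card_set card_prod !card_ord card_bool.
  (* One level costs 2 m bits for [U] and 36 m for [K]. As m <= 522 q, these 38 m bits are covered
     by the 38 * 522 bits granted to each of the [q] vertices removed. *)
  apply: (@leq_trans (2 ^ (38 * 522 * m) * 2 ^ (m * 2) * 2 ^ (36 * m))).
    by rewrite !leq_mul2r cI !orbT.
  rewrite -!expnD leq_exp2l //.
  have -> : n = m + q by rewrite /m subnK.
  have : m <= 522 * q by rewrite /m; lia.
  lia.
move=> T e es ei free Tn.
have [f0 pf0 f0n] := large_pairing es ei free.
have [|f pf fq] := @pairing_restrict _ e f0 q pf0; first by rewrite Tn in f0n; rewrite /q; lia.
have Fm : #|{: {x : T | f x == x}}| = m by rewrite card_fixpoint Tn fq.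
have [i [h [hinj hg]]] := Hg _ _ (quotient_edge_sym es pf) (quotient_edge_irr pf)
  (@quotient_K5_free _ _ es _ pf free) Fm.
have hbij : bijective h by apply: inj_card_bij => //; rewrite card_ord Fm.
pose psi x := (h (class pf x), f x != x).
have psi_inj : injective psi.
  by move=> x y [/hinj cxy mxy]; apply: (@class_pair_inj _ _ _ pf); rewrite cxy mxy.
pose U := [set psi x | x : T]; pose E2 := lex_edges (g i).
have psiE x y : e x y -> (psi x, psi y) \in E2.
  move=> xy; rewrite inE /= -hg /quotient_edge.
  have [->|cxy] := eqVneq (class pf x) (class pf y); first by rewrite eqxx.
  by apply/orP; right; apply/existsP; exists x; apply/existsP; exists y; rewrite !eqxx.
have cE2 : #|E2| <= 36 * m.
  apply: card_lex_edges; rewrite -[X in _ <= 8 * X]Fm.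
  have /K5_free_sparse := @quotient_K5_free _ _ es _ pf free.
  move=> /(_ (quotient_edge_sym es pf) (quotient_edge_irr pf)); rewrite cardsT /arcs.
  apply: leq_trans; apply: eq_leq; rewrite (reindex h) /=; last exact: onW_bij.
  apply: eq_big => [x|x _]; first by rewrite inE.
  rewrite (reindex h) /=; last exact: onW_bij.
  by apply: eq_big => [y|y _]; rewrite ?inE // hg.
pose K := [set k : 'I_(36 * m) | [exists x, exists y, e x y && (index (psi x, psi y) (enum E2) == k)]].
have cU : #|U| = n by rewrite card_imset // Tn.
have hP x : index (psi x) (enum U) < n.
  by rewrite -[X in _ < X]cU cardE index_mem mem_enum imset_f.
exists (i, U, K), (fun x => Ordinal (hP x)); split.
  by move=> x y [] /(congr1 (nth (psi x) (enum U))); rewrite !nth_index ?mem_enum ?imset_f // => /psi_inj.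
move=> x y; apply/idP/existsP => [xy|[u /andP[uU /existsP[v /andP[vU /and3P[/eqP ux /eqP vy]]]]]].
  exists (psi x); rewrite imset_f //=; apply/existsP; exists (psi y); rewrite imset_f //= !eqxx /=.
  have kP : index (psi x, psi y) (enum E2) < 36 * m.
    by apply: leq_trans cE2; rewrite cardE index_mem mem_enum psiE.
  apply/existsP; exists (Ordinal kP); rewrite inE eqxx andbT.
  by apply/existsP; exists x; apply/existsP; exists y; rewrite xy /=.
have {}ux : u = psi x.
  by move/(congr1 (nth u (enum U))): ux; rewrite !nth_index ?mem_enum ?imset_f.
have {}vy : v = psi y.
  by move/(congr1 (nth v (enum U))): vy; rewrite !nth_index ?mem_enum ?imset_f.
move=> /existsP[k /andP[]]; rewrite inE => /existsP[x' /existsP[y' /andP[xy' /eqP <-]]] /eqP E.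
have E2xy' : (psi x', psi y') \in enum E2 by rewrite mem_enum psiE.
have : (u, v) = (psi x', psi y').
  have E2uv : (u, v) \in enum E2 by rewrite -index_mem E index_mem.
  by move/(congr1 (nth (u, v) (enum E2))): E; rewrite !nth_index.
rewrite ux vy => -[/hinj cx mx /hinj cy my].
by rewrite (@class_pair_inj _ _ _ pf x x') ?cx ?mx //
  (@class_pair_inj _ _ _ pf y y') ?cy ?my.
Qed.

(** * The evaluation grid *)

(* Column [j] of the grid stands for a clause, row [i] for a variable.  In an
   independent set meeting every block, a row carries the signal "the variable is
   available" to the right and a column the signal "the clause is satisfied"
   downwards; both can only drop from 1 to 0, except that [Tap] raises the column
   signal when the next row carries 1.  [C1], [C2], [C3], [C4] encode the signals
   (row, column) = (1,1), (0,1), (0,0), (1,0) in a crossing, one of which is forced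
   by the triangles [C1 C2 Z1] and [C3 C4 Z2] and the edge [Z1 Z2].  [Left] belongs
   to cell (j, i) although it is the left port of cell (j+1, i), and likewise [Top]
   and [Tap] sit on top of cell (j, i+1), so that every block lies in one cell.
   The pairs [P1 Q1] and [P2 Q2] only subdivide the edges [Left C4] and [Right C2]. *)
Inductive label := C1 | C2 | C3 | C4 | Z1 | Z2 | P1 | Q1 | P2 | Q2 | Right | Left | Bottom | Top | Tap.

Definition labels := [:: C1; C2; C3; C4; Z1; Z2; P1; Q1; P2; Q2; Right; Left; Bottom; Top; Tap].

Definition label_code (a : label) : 'I_15 :=
  inord match a with
  | C1 => 0 | C2 => 1 | C3 => 2 | C4 => 3 | Z1 => 4 | Z2 => 5 | P1 => 6 | Q1 => 7
  | P2 => 8 | Q2 => 9 | Right => 10 | Left => 11 | Bottom => 12 | Top => 13 | Tap => 14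
  end.

Lemma label_codeK : cancel label_code (nth C1 labels).
Proof. by case; rewrite /label_code inordK. Qed.

HB.instance Definition _ := Equality.copy label (can_type label_codeK).
HB.instance Definition _ := Choice.copy label (can_type label_codeK).
HB.instance Definition _ := Countable.copy label (can_type label_codeK).
HB.instance Definition _ := Finite.copy label (can_type label_codeK).

Definition inner (a a' : label) : bool :=
  match a, a' with
  | C1, C2 | C1, Z1 | C2, Z1 | C3, C4 | C3, Z2 | C4, Z2 | Z1, Z2
  | P1, Q1 | Q1, C4 | P2, Q2 | Q2, C2 | Right, C3 | Right, P2 | Right, Left
  | Bottom, C3 | Bottom, C4 | Bottom, Top | Bottom, Tap | Tap, Top => true
  | _, _ => false
  end.

Definition outer (j i : nat) (a : label) (j' i' : nat) (a' : label) : bool :=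
  match a, a' with
  | Left, C1 | Left, P1 => (j' == j.+1) && (i' == i)
  | Left, Tap => (j' == j.+1) && (i == i'.+1)
  | Top, C1 | Top, C2 => (j' == j) && (i' == i.+1)
  | _, _ => false
  end.

Definition block (a : label) : label :=
  match a with
  | C1 | C2 | Z1 => C1
  | C3 | C4 | Z2 => C3
  | P1 | Q1 => P1
  | P2 | Q2 => P2
  | Right | Left => Right
  | Bottom | Top | Tap => Bottom
  end.

Section Grid.
Variables (N t : nat) (lit : nat -> nat -> bool).

Definition grid_vertex : finType := ('I_N.+1 * 'I_t.+1 * label)%type.
Implicit Types (u v : grid_vertex) (S : {set grid_vertex}) (X : {set 'I_t}).

(* The other vertices are kept as isolated vertices, so that the vertex type does not
   depend on the clauses. *)
Definition present (j i : nat) (a : label) : bool :=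
  match a with
  | Right | Left => 0 < i
  | Top => (i < t) && (0 < j)
  | Tap => [&& i < t, 0 < j & lit j i]
  | _ => (0 < i) && (0 < j)
  end.

Definition joins (j i : nat) (a : label) (j' i' : nat) (a' : label) : bool :=
  [&& present j i a, present j' i' a' &
    [&& j == j', i == i' & inner a a'] || outer j i a j' i' a'].

Definition grid_arc : rel grid_vertex :=
  fun u v => joins u.1.1 u.1.2 u.2 v.1.1 v.1.2 v.2.

Definition grid_edge : rel grid_vertex := fun u v => grid_arc u v || grid_arc v u.

Lemma grid_edge_sym : symmetric grid_edge.
Proof. by move=> u v; rewrite /grid_edge orbC. Qed.

Lemma grid_edge_irrefl : irreflexive grid_edge.
Proof.
move=> [[j i] a]; rewrite /grid_edge orbb /grid_arc /joins /=.
by case: a => /=; rewrite !(eqxx, andbF, orbF, andFb).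
Qed.

Definition grid : sgraph := SGraph grid_edge_sym grid_edge_irrefl.

(** Column 0 and row 0 hold no crossings; they only feed in the row and column signals. Hence
    variable [i] lives in row [i.+1], and clauses are numbered from 1. *)
Definition grid_boundary (i : 'I_t) : grid := (ord0, lift ord0 i, Right).

Lemma grid_boundary_inj : injective grid_boundary.
Proof. by move=> i i' /(congr1 (fun v : grid_vertex => v.1.2)) /lift_inj. Qed.

Definition bgrid : bgraph t := @BGraph t grid grid_boundary grid_boundary_inj.

(* Every edge is a step of the triangular lattice, and since (5,3) and (3,6) span a
   sublattice of index 21 the residue of 3x + 2y modulo 21 determines the label. *)
Definition position (j i : nat) (a : label) : nat * nat :=
  let: (x, y) := match a with
    | C1 => (1, 1) | C2 => (2, 1) | Z1 => (2, 2) | Z2 => (2, 3) | C4 => (2, 4) | C3 => (3, 4)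
    | P1 => (0, 2) | Q1 => (1, 3) | P2 => (4, 3) | Q2 => (3, 2) | Right => (4, 4)
    | Left => (5, 4) | Bottom => (3, 5) | Top => (4, 6) | Tap => (3, 6)
    end in (5 * j + 3 * i + x, 3 * j + 6 * i + y).

Lemma position_inj j i a j' i' a' : position j i a = position j' i' a' ->
  [/\ j = j', i = i' & a = a'].
Proof.
by case: a; case: a'; rewrite /position => -[] E1 E2; split=> //; lia.
Qed.

Definition lattice_step (z z' : nat * nat) : bool :=
  (z' \in [:: (z.1.+1, z.2); (z.1, z.2.+1); (z.1.+1, z.2.+1)]).

Lemma joins_step j i a j' i' a' : joins j i a j' i' a' ->
  lattice_step (position j i a) (position j' i' a') ||
  lattice_step (position j' i' a') (position j i a).
Proof.
move=> /and3P[_ _ /orP[/and3P[/eqP<- /eqP<-]|]].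
  by case: a; case: a' => // _; rewrite /lattice_step /position /= !inE !xpair_eqE;
     apply/orP; rewrite -!addnS !eqn_add2l /=; (try by left); right.
by case: a; case: a' => //= /andP[/eqP-> /eqP->];
   rewrite /lattice_step /position /= !inE !xpair_eqE; apply/orP; lia.
Qed.

End Grid.

(** * A path decomposition of the grid in reading order *)

Section Pathwidth.
Variables (N t : nat) (lit : nat -> nat -> bool).
Implicit Types (u v : grid N t lit).

Definition key v : nat := v.1.1 * t.+1 + v.1.2.

(* In reading order a [Left] vertex still has neighbours t and t + 1 cells later. *)
Definition span (a : label) : nat := if a is Left then t.+1 else 1.

Lemma spanE a : span a = if a == Left then t.+1 else 1.
Proof. by case: a; case: eqP. Qed.

Definition bag (k : nat) : {set grid N t lit} := [set v | key v <= k <= key v + span v.2].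

Definition bags : seq {set grid N t lit} := [seq bag k | k <- iota 0 (N.+1 * t.+1)].

Lemma key_lt v : key v < N.+1 * t.+1.
Proof.
case: v => [[j i] a]; rewrite /key /=; have := ltn_ord j; have := ltn_ord i.
by move=> iH jH; apply: (@leq_trans (j.+1 * t.+1)); [rewrite mulSn; lia | rewrite leq_mul2r jH orbT].
Qed.

Lemma key_inj u v : key u = key v -> u.2 = v.2 -> u = v.
Proof.
case: u v => [[j i] a] [[j' i'] a']; rewrite /key /= => E ->.
have jj : j = j' :> nat.
  by have := congr1 (divn^~ t.+1) E; rewrite /= !divnMDl // !divn_small ?addn0.
have ii : i = i' :> nat by move: E; rewrite jj => /addnI.
by rewrite (val_inj jj) (val_inj ii).
Qed.

(** A vertex of a bag is determined by its label and its age [k - key v]. There are t + 2 ages for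
    [Left], and 2 ages with at most 15 labels for the rest. *)
Lemma card_bag k : #|bag k| <= t + 32.
Proof.
pose f v : 'I_t.+2 + 'I_2 * label :=
  if v.2 == Left then inl (inord (k - key v)) else inr (inord (k - key v), v.2).
have finj : {in bag k &, injective f}.
  move=> u v; rewrite !inE /f !spanE => /andP[u1 u2] /andP[v1 v2].
  case: (eqVneq u.2 Left) u2 => [ua|ua] u2; case: (eqVneq v.2 Left) v2 => [va|va] v2 //.
    move=> [] /(congr1 val); rewrite /= !inordK //; try lia.
    by move=> E; apply: key_inj; [lia | rewrite ua va].
  move=> [] /(congr1 val); rewrite /= !inordK //; try lia.
  by move=> E ?; apply: key_inj => //; lia.
have label15 : #|{: label}| <= 15.
  by rewrite -[X in _ <= X]card_ord; apply: (leq_card label_code); exact: can_inj label_codeK.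
rewrite -(card_in_imset finj); apply: leq_trans (max_card _) _.
rewrite card_sum card_prod !card_ord (_ : t + 32 = t.+2 + 2 * 15); last lia.
by rewrite leq_add2l leq_mul2l.
Qed.

Lemma mem_bag v : v \in bag (key v).
Proof. by rewrite inE leqnn leq_addr. Qed.

Lemma arc_bag u v : grid_arc lit u v -> exists2 k, k < N.+1 * t.+1 & (u \in bag k) && (v \in bag k).
Proof.
case: u v => [[j i] a] [[j' i'] a'] uv.
suff [le_uv|le_vu] : key (j, i, a) <= key (j', i', a') <= key (j, i, a) + span a \/
    key (j', i', a') <= key (j, i, a) <= key (j', i', a') + span a'.
- by exists (key (j', i', a')); rewrite ?key_lt // mem_bag inE /= le_uv.
- by exists (key (j, i, a)); rewrite ?key_lt // mem_bag inE /= le_vu.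
move: uv; rewrite /grid_arc /joins /= => /and3P[_ _ /orP[/and3P[/eqP jj /eqP ii _]|]].
  by left; rewrite /key /= jj ii leqnn leq_addr.
rewrite /key /span /=; case: a; case: a' => //= /andP[/eqP-> /eqP->]; left; rewrite ?mulSn; lia.
Qed.

Lemma bags_path_decomposition : path_decomposition bags.
Proof.
split=> [v|u v uv|v i j k ij jk].
- exists (bag (key v)); last exact: mem_bag.
  by apply: map_f; rewrite mem_iota key_lt.
- suff [k kN kuv] : exists2 k, k < N.+1 * t.+1 & (u \in bag k) && (v \in bag k).
    by exists (bag k) => //; apply: map_f; rewrite mem_iota.
  case/orP: uv => /arc_bag[k kN kuv]; exists k => //.
  by rewrite andbC.
rewrite size_map size_iota => kN.
have nthE h : h <= k -> nth finset.set0 bags h = bag h.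
  move=> hk; have hN : h < N.+1 * t.+1 by apply: leq_ltn_trans kN.
  by rewrite (nth_map 0) ?size_iota // nth_iota.
have [iH] : i <= k /\ j <= k by rewrite (leq_trans ij jk) jk.
rewrite !nthE // !inE; lia.
Qed.

Lemma pathwidth_grid : pathwidth (grid N t lit) <= t + 31.
Proof.
suff wB : width bags <= t + 31.
  rewrite /pathwidth; case: ex_minnP => m _ minm; apply: leq_trans wB; apply: minm.
  by apply/boolp.asboolP; exists bags => //; exact: bags_path_decomposition.
rewrite /width; suff : \max_(Y <- bags) #|Y| <= t + 32 by lia.
rewrite big_map; apply/bigmax_leqP_seq => k _ _; exact: card_bag.
Qed.

End Pathwidth.

(** * Independent sets of the grid that meet every block *)

Definition restricted_opt (t : nat) (G : bgraph t) (X : {set 'I_t}) : nat :=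
  \max_(S : {set G} | independent S && [forall i, (boundary G i \in S) ==> (i \in X)]) #|S|.

Section Saturation.
Variables (N t : nat) (lit : nat -> nat -> bool).
Local Notation G := (bgrid N t lit).
Implicit Types (u v : G) (S : {set G}) (X : {set 'I_t}).

Lemma independentP (H : sgraph) (S : {set H}) :
  reflect {in S &, forall x y, ~~ sedge x y} (independent S).
Proof.
apply: (iffP forall_inP) => [H1 x y xS yS|H1 x xS]; first by apply: (forall_inP (H1 x xS)).
by apply/forall_inP => y yS; apply: H1.
Qed.

(** Index of the clique of [v] in the clique partition. Absent vertices are isolated and form
    singletons; the flag separates them from the present blocks of the same cell. *)
Definition clique_of v : grid_vertex N t * bool :=
  let p := present t lit v.1.1 v.1.2 v.2 in (v.1, if p then block v.2 else v.2, p).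

Definition saturation : nat := #|[set clique_of v | v : G]|.

Lemma block_inner a a' : block a = block a' -> [|| a == a', inner a a' | inner a' a].
Proof. by case: a; case: a' => //= _; rewrite ?orbT ?eqxx. Qed.

Lemma clique_of_inj S : independent S -> {in S &, injective clique_of}.
Proof.
move=> /independentP indS [[j i] a] [[j' i'] a'] uS vS.
have := indS _ _ uS vS; rewrite /clique_of /= /grid_edge /grid_arc /joins /=.
move=> nuv E; have [/= jj ii] : j = j' /\ i = i' by case: E.
subst j' i'; have pp := congr1 snd E; rewrite /= in pp.
have := congr1 (fun z => z.1.2) E; rewrite /= -pp.
move: nuv; rewrite -pp !eqxx /=; case: (present _ _ _ _ _) => /=; last by move=> _ ->.
rewrite !negb_or -!andbA => /and4P[n1 _ n2 _] /block_inner.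
by rewrite (negbTE n1) (negbTE n2) !orbF => /eqP->.
Qed.

Lemma card_independent S : independent S -> #|S| <= saturation.
Proof.
move=> indS; rewrite -(card_in_imset (clique_of_inj indS)); apply: subset_leq_card.
by apply/subsetP => _ /imsetP[v _ ->]; apply: imset_f.
Qed.

Lemma saturatedP S : independent S ->
  reflect (forall v, exists2 s, s \in S & clique_of s = clique_of v) (#|S| == saturation).
Proof.
move=> indS; rewrite -(card_in_imset (clique_of_inj indS)).
have sub : clique_of @: S \subset [set clique_of v | v : G].
  by apply/subsetP => _ /imsetP[v _ ->]; apply: imset_f.
apply: (iffP idP) => [/eqP E v|H].
  have /eqP/setP/(_ (clique_of v)) : clique_of @: S == [set clique_of v | v : G].
    by rewrite eqEcard sub E leqnn.
  by rewrite [in RHS]imset_f // => /imsetP[s sS ->]; exists s.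
apply/eqP; congr #|pred_of_set _|; apply/eqP; rewrite eqEsubset sub.
by apply/subsetP => _ /imsetP[v _ ->]; have [s sS <-] := H v; apply: imset_f.
Qed.

Section Forward.
Variables (S : {set G}) (X : {set 'I_t}).
Hypotheses (indS : independent S) (satS : #|S| = saturation).
Hypothesis SX : forall i, boundary G i \in S -> i \in X.

Let M (j i : nat) (a : label) : bool := ((inord j, inord i, a) : G) \in S.

Lemma hit j i a : j <= N -> i <= t -> present t lit j i a ->
  exists a', [/\ block a' = block a, present t lit j i a' & M j i a'].
Proof.
move=> jN it pa; have /eqP/(saturatedP indS) H := satS.
have [[[j' i'] a'] sS] := H (inord j, inord i, a).
rewrite /clique_of /= !inordK // pa => E.
have [jj ii] : j' = inord j /\ i' = inord i by case: E.
subst j' i'; move: E; rewrite !inordK //.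
case pa' : (present t lit j i a') => //= -[E].
by exists a'; split.
Qed.

Lemma nadj j i a j' i' a' : j <= N -> i <= t -> j' <= N -> i' <= t ->
  joins t lit j i a j' i' a' -> M j i a -> M j' i' a' = false.
Proof.
move=> jN it j'N i't ar Mu; apply/negbTE/negP => Mv.
have := independentP _ indS _ _ Mu Mv.
by rewrite /= /grid_edge /grid_arc /= !inordK // ar.
Qed.

Let blocks j i : 0 < j <= N -> 0 < i <= t ->
  [/\ [|| M j i C1, M j i C2 | M j i Z1], [|| M j i C3, M j i C4 | M j i Z2],
      M j i P1 || M j i Q1 & M j i P2 || M j i Q2].
Proof.
move=> /andP[j0 jN] /andP[i0 it].
by split; [have := @hit j i C1 | have := @hit j i C3 | have := @hit j i P1 | have := @hit j i P2];
   rewrite /= j0 i0 => /(_ jN it isT) [a' [ba _]];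
   case: a' ba => //= _ ->; rewrite ?orbT.
Qed.

Let link j i : j <= N -> 0 < i <= t -> M j i Right || M j i Left.
Proof.
move=> jN /andP[i0 it]; have := @hit j i Right jN it; rewrite /= i0 => /(_ isT) [a' [ba _]].
by case: a' ba => //= _ ->; rewrite ?orbT.
Qed.

(** A row signal 0 survives each crossing. [Left] of the previous column forces [Q1] and excludes
    [C1] and [C4]; [Right] would force [Q2] and exclude [C3] and [C2], leaving only the adjacent
    [Z1] and [Z2] for the two triangles. *)
Lemma Left_unavailable (k : 'I_t) j : k \notin X -> j <= N -> M j k.+1 Left.
Proof.
move=> kX; have kt := ltn_ord k; elim: j => [|j IHj] jN.
  have := @link 0 k.+1 isT kt; case/orP => // Mr.
  suff : boundary G k \in S by move/SX; rewrite (negbTE kX).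
  suff -> : boundary G k = (inord 0, inord k.+1, Right) by [].
  rewrite /= /grid_boundary; congr (_, _, _); apply: ord_inj; rewrite inordK //.
have Ml := IHj (ltnW jN); have j'N : 0 < j.+1 <= N by [].
have jN' := ltnW jN.
have [c12 c34 pq pq'] := @blocks j.+1 k.+1 j'N kt.
have nC1 : M j.+1 k.+1 C1 = false.
  by apply: nadj Ml => //; rewrite /joins /= !eqxx orbT.
have nP1 : M j.+1 k.+1 P1 = false.
  by apply: nadj Ml => //; rewrite /joins /= !eqxx orbT.
have in_arc a a' : inner a a' -> present t lit j.+1 k.+1 a -> present t lit j.+1 k.+1 a' ->
    M j.+1 k.+1 a -> M j.+1 k.+1 a' = false.
  by move=> aa pa pa'; apply: nadj => //; rewrite /joins pa pa' !eqxx aa.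
have := @link j.+1 k.+1 jN kt; case/orP => // Mr; exfalso.
have nC3 := in_arc Right C3 isT isT isT Mr; have nP2 := in_arc Right P2 isT isT isT Mr.
rewrite nP1 /= in pq; rewrite nP2 /= in pq'.
have nC4 := in_arc Q1 C4 isT isT isT pq; have nC2 := in_arc Q2 C2 isT isT isT pq'.
rewrite nC1 nC2 /= in c12; rewrite nC3 nC4 /= in c34.
by have := in_arc Z1 Z2 isT isT isT c12; rewrite c34.
Qed.

(** Without an available literal every [Tap] of the column is blocked by a [Left], so the signal 0
    set in row 0 is passed on through [Top] down to row [t]. There only [Bottom] is left in the last
    block, but [Top] forces [Z1], hence [C3] or [C4], which exclude [Bottom]. *)
Lemma saturated_clause j : 0 < t -> 0 < j <= N -> exists2 k : 'I_t, k \in X & lit j k.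
Proof.
move=> t0 jN; have [j0 jN'] := andP jN.
apply/exists_inP; apply: contraT; rewrite negb_exists_in => /forall_inP noX.
suff MT i : i < t -> M j i Top.
  have := MT t.-1; rewrite prednK // leqnn => /(_ isT) Mt.
  have tt : 0 < t <= t by rewrite t0 leqnn.
  have [c12 c34 _ _] := blocks jN tt.
  have noC a : (if a is C1 then true else if a is C2 then true else false) -> M j t a = false.
    move=> aE; apply: nadj Mt; rewrite ?leq_pred //.
    by case: a aE => // _; rewrite /joins /= ?prednK // leqnn j0 t0 !eqxx ?orbT.
  have in_arc a a' : inner a a' -> present t lit j t a -> present t lit j t a' ->
      M j t a -> M j t a' = false.
    by move=> aa pa pa'; apply: nadj => //; rewrite /joins pa pa' !eqxx aa.
  have cZ : M j t Z1 by move: c12; rewrite (noC C1) ?(noC C2).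
  have pj a : (if a is Top then false else if a is Tap then false else true) -> present t lit j t a.
    by case: a; rewrite /= ?t0 ?j0.
  have {}c34 : M j t C3 || M j t C4 by move: c34; rewrite (in_arc Z1 Z2) ?pj // orbF.
  have := @hit j t Bottom jN' (leqnn t); rewrite /= t0 j0 => /(_ isT) [a' [ba pa Ma]].
  case: a' ba pa Ma => //=; rewrite ?ltnn // => _ _ MB.
  by move: c34; rewrite (in_arc Bottom C3) ?(in_arc Bottom C4) ?pj.
have noTap h : h < t -> lit j h -> M j h Tap = false.
  move=> it lji.
  have iX : Ordinal it \notin X by apply/negP => /noX /=; rewrite lji.
  have Ml := @Left_unavailable (Ordinal it) j.-1 iX (leq_trans (leq_pred _) jN').
  apply: nadj Ml => //=; rewrite ?(ltnW it) ?(leq_trans (leq_pred _) jN') //.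
  by rewrite /joins /= it j0 lji prednK ?eqxx ?orbT.
elim: i => [|i IHi] it.
  have := @hit j 0 Top jN' (leq0n t); rewrite /= t0 j0 => /(_ isT) [a' [ba pa Ma]].
  case: a' ba pa Ma => //= _; rewrite ?andbF // => /and3P[_ _ lj0].
  by rewrite noTap.
have Mt := IHi (ltnW it); have iN : 0 < i.+1 <= t by exact: ltnW.
have it' := ltnW it; have it'' := ltnW it'.
have [c12 c34 _ _] := blocks jN iN.
have noC a : (if a is C1 then true else if a is C2 then true else false) -> M j i.+1 a = false.
  move=> aE; apply: nadj Mt => //.
  by case: a aE => // _; rewrite /joins /= it' j0 !eqxx ?orbT.
have in_arc a a' : inner a a' -> present t lit j i.+1 a -> present t lit j i.+1 a' ->
    M j i.+1 a -> M j i.+1 a' = false.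
  by move=> aa pa pa'; apply: nadj => //; rewrite /joins pa pa' !eqxx aa.
have cZ : M j i.+1 Z1 by move: c12; rewrite (noC C1) ?(noC C2).
have pj a : (if a is Top then false else if a is Tap then false else true) -> present t lit j i.+1 a.
  by case: a; rewrite /= ?j0.
have {}c34 : M j i.+1 C3 || M j i.+1 C4 by move: c34; rewrite (in_arc Z1 Z2) ?pj // orbF.
have := @hit j i.+1 Top jN' it'; rewrite /= it j0 => /(_ isT) [a' [ba pa Ma]].
case: a' ba pa Ma => //= _; first last.
- by move=> /and3P[_ _ lj] ; rewrite noTap.
- by move=> _ MB; move: c34; rewrite (in_arc Bottom C3) ?(in_arc Bottom C4) ?pj.
Qed.

End Forward.
Section Backward.
Variable X : {set 'I_t}.
Hypothesis hitX : forall j, 0 < j <= N -> exists2 k : 'I_t, k \in X & lit j k.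

Definition on (i : nat) : bool := [exists k in X, k == i :> nat].

Fixpoint satisfied (j i : nat) : bool :=
  if i is i'.+1 then satisfied j i' || (lit j i' && on i') else false.

(** [h] is the signal of row [i], that is of variable [i.-1], and [s] the signal of column [j]
    inside row [i], after the tap above it. *)
Definition selected (j i : nat) (a : label) : bool :=
  let h := on i.-1 in let s := satisfied j i in
  match a with
  | C1 => h && s | C2 => ~~ h && s | Z1 => ~~ s
  | C3 => ~~ h && ~~ s | C4 => h && ~~ s | Z2 => s
  | Right | P1 | Q2 => h
  | Left | Q1 | P2 => ~~ h
  | Bottom => s
  | Top => ~~ s && ~~ (lit j i && on i)
  | Tap => ~~ s && (lit j i && on i)
  end.

Lemma satisfied_last j : 0 < j <= N -> satisfied j t.
Proof.
move=> /hitX[k kX ljk]; have onk : on k by apply/exists_inP; exists k.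
suff H d : satisfied j (k.+1 + d) by have := H (t - k.+1); rewrite subnKC.
by elim: d => [|d IHd]; [rewrite addn0 /= ljk onk orbT | rewrite addnS; exact: (introT orP (or_introl IHd))].
Qed.

Definition selection : {set G} :=
  [set v : G | present t lit v.1.1 v.1.2 v.2 ==> selected v.1.1 v.1.2 v.2].

Lemma joins_selected j i a j' i' a' : joins t lit j i a j' i' a' ->
  selected j i a -> selected j' i' a' -> False.
Proof.
move=> /and3P[pa pa' /orP[/and3P[/eqP<- /eqP<-]|]].
  by move: pa pa'; case: a; case: a' => //= _ _ _;
     try case: (lit _ _); try case: (satisfied _ _); try case: (on _); rewrite //= ?andbF.
move: pa pa'; case: a; case: a' => //= _ _ /andP[/eqP jj /eqP ii]; subst => /=.
all: try case: (lit _ _); try case: (satisfied _ _); try case: (on _); rewrite //= ?andbF.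
Qed.

Lemma independent_selection : independent selection.
Proof.
apply/independentP => u v; rewrite !inE => uS vS; apply/negP => uv.
have step (w z : G) : present t lit w.1.1 w.1.2 w.2 ==> selected w.1.1 w.1.2 w.2 ->
    present t lit z.1.1 z.1.2 z.2 ==> selected z.1.1 z.1.2 z.2 -> grid_arc lit w z -> False.
  move=> wS zS wz; have /and3P[pw pz _] := wz; rewrite pw in wS; rewrite pz in zS.
  exact: joins_selected wz wS zS.
by case/orP: uv; apply: step.
Qed.

Lemma card_selection : #|selection| = saturation.
Proof.
apply/eqP/(saturatedP independent_selection) => -[[j i] a].
have [pa|pa] := boolP (present t lit j i a); last first.
  by exists (j, i, a); rewrite // inE /= (negbTE pa).
suff [a' [ba pa' sa]] : exists a', [/\ block a' = block a, present t lit j i a' & selected j i a'].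
  by exists (j, i, a'); [rewrite inE /= pa' | rewrite /clique_of /= pa pa' ba].
have bottom : 0 < j -> block a = Bottom ->
    exists a', [/\ block a' = block a, present t lit j i a' & selected j i a'].
  move=> j0 ->; case st : (satisfied j i).
    by exists Bottom; rewrite /= st j0; split=> //; case: (nat_of_ord i) st.
  (* In row [t] the block consists of [Bottom] alone, which is selected because the clause is
     satisfied by then. *)
  have it : i < t.
    rewrite ltn_neqAle -ltnS ltn_ord andbT; apply/eqP => it.
    by have := @satisfied_last j; rewrite j0 -ltnS ltn_ord -it st => /(_ isT).
  case lo : (lit j i && on i); last by exists Top; rewrite /= st lo it.
  by exists Tap; rewrite /= st lo it j0; case/andP: lo.
move: pa bottom; case: a => /= pa bottom; try by apply: bottom; case/and3P: pa || case/andP: pa.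
all: case o : (on i.-1); case st : (satisfied j i).
all: try by exists C1; rewrite /= o st.
all: try by exists C2; rewrite /= o st.
all: try by exists Z1; rewrite /= st.
all: try by exists C3; rewrite /= o st.
all: try by exists C4; rewrite /= o st.
all: try by exists Z2; rewrite /= st.
all: try by exists P1; rewrite /= o.
all: try by exists Q1; rewrite /= o.
all: try by exists P2; rewrite /= o.
all: try by exists Q2; rewrite /= o.
all: try by exists Right; rewrite /= o.
all: by exists Left; rewrite /= o.
Qed.

Lemma boundary_selection k : boundary G k \in selection -> k \in X.
Proof. by rewrite inE /= /on => /exists_inP[k' k'X /eqP/val_inj <-]. Qed.

End Backward.

Lemma restricted_opt_bgrid X : 0 < t ->
  restricted_opt G X <= saturation /\
  (restricted_opt G X == saturation <-> forall j, 0 < j <= N -> exists2 k : 'I_t, k \in X & lit j k).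
Proof.
move=> t0; have le_sat : restricted_opt G X <= saturation.
  by apply/bigmax_leqP => S /andP[indS _]; exact: card_independent.
split=> //; split=> [/eqP E j jN|hitX].
  have S0 : independent (finset.set0 : {set G}) &&
      [forall i, (boundary G i \in (finset.set0 : {set G})) ==> (i \in X)].
    by apply/andP; split; [apply/independentP => x y; rewrite inE | apply/forallP => i; rewrite inE].
  pose A := [pred S : {set G} | independent S & [forall i, (boundary G i \in S) ==> (i \in X)]].
  have A0 : 0 < #|A| by apply/card_gt0P; exists finset.set0.
  have [S /andP[indS /forallP avS] ES] := eq_bigmax_cond (fun S : {set G} => #|S|) A0.
  apply: (@saturated_clause S X indS) => //.
    by rewrite -E -ES; apply: eq_bigl.
  by move=> i iS; have := avS i; rewrite iS.
rewrite eqn_leq le_sat -(card_selection hitX); apply: (bigmax_sup (selection X)) => //.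
rewrite independent_selection; apply/forallP => i; apply/implyP; exact: boundary_selection.
Qed.

End Saturation.

(** * Reading off the restricted optima by gluing *)

Section Tester.
Variables (t : nat) (X : {set 'I_t}).

(** A leaf exists for every label and is merely isolated for labels in [X], so the leaves contribute
    [t] whatever [X] is. *)
Definition leaf_edge : rel (bool * 'I_t) :=
  fun u v => [&& u.1 != v.1, u.2 == v.2 & u.2 \notin X].

Lemma leaf_edge_sym : symmetric leaf_edge.
Proof.
move=> u v; rewrite /leaf_edge eq_sym; congr (_ && _).
by rewrite eq_sym; case: eqP => // ->.
Qed.

Lemma leaf_edge_irrefl : irreflexive leaf_edge.
Proof. by move=> u; rewrite /leaf_edge eqxx. Qed.

Definition leaves : sgraph := SGraph leaf_edge_sym leaf_edge_irrefl.

Lemma leaf_inj : injective (pair false : 'I_t -> leaves).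
Proof. by move=> i j []. Qed.

Definition tester : bgraph t := BGraph leaf_inj.

Variable G : bgraph t.
Local Notation pi := (@glue_pi t G tester).

Lemma glue_vertexP (w : glue G tester) :
  (exists x, w = pi (inl x)) \/ (exists i, w = pi (inr (true, i))).
Proof.
rewrite -[w]reprK -/(pi _); case: (repr w) => [x|[[] i]]; [by left; exists x | by right; exists i |].
left; exists (boundary G i); apply/esym/glue_piP; rewrite /glue_rel /same_label.
by apply/or3P/Or32/existsP; exists i; rewrite !eqxx.
Qed.

Lemma pi_inl_inj x y : pi (inl x) = pi (inl y) -> x = y.
Proof. by move/glue_piP; rewrite /glue_rel /same_label => /or3P[/eqP[]||] // /existsP[i /andP[]]. Qed.

Lemma pi_leaf i u : pi (inr (true, i)) = pi u -> u = inr (true, i).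
Proof.
by move/glue_piP; rewrite /glue_rel /same_label => /or3P[/eqP<-||] // /existsP[j /andP[]] => [|/eqP->] // _ /eqP[].
Qed.

Lemma pi_edge u v : dunion_edge u v -> sedge (pi u : glue G tester) (pi v).
Proof. by move=> uv; apply/existsP; exists u; apply/existsP; exists v; rewrite !eqxx. Qed.

Lemma pi_boundary i : pi (inr (false, i)) = pi (inl (boundary G i)).
Proof.
apply/glue_piP; rewrite /glue_rel /same_label.
by apply/or3P/Or33/existsP; exists i; rewrite !eqxx.
Qed.

(* A boundary vertex outside [X] can always be exchanged for its leaf. *)
Lemma opt_glue_tester : opt_IS (glue G tester) = restricted_opt G X + t.
Proof.
apply/eqP; rewrite eqn_leq; apply/andP; split.
  apply/bigmax_leqP => S' /independentP indS'.
  pose S := [set x | (pi (inl x) \in S') && [forall i, (x == boundary G i) ==> (i \in X)]].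
  pose g i := if pi (inr (true, i)) \in S' then pi (inr (true, i)) else pi (inl (boundary G i)).
  have sub : S' \subset [set pi (inl x) | x in S] :|: [set g i | i in 'I_t].
    apply/subsetP => w wS'; rewrite inE.
    case: (glue_vertexP w) => [[x wE]|[i wE]]; last first.
      by apply/orP; right; apply/imsetP; exists i => //; rewrite /g -wE wS'.
    have [xS|] := boolP (x \in S); first by apply/orP; left; apply/imsetP; exists x.
    rewrite inE -wE wS' /= => /forallPn[i]; rewrite negb_imply => /andP[/eqP xE iX].
    apply/orP; right; apply/imsetP; exists i => //; rewrite /g -xE -wE.
    case: ifP => // lS'; have := indS' _ _ lS' wS'; rewrite wE xE -pi_boundary => /negP[].
    by apply: pi_edge; rewrite /= /leaf_edge /= eqxx.
  apply: leq_trans (subset_leq_card sub) _; apply: leq_trans (leq_card_setU _ _) _.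
  apply: leq_add; last by apply: leq_trans (leq_imset_card _ _) _; rewrite card_ord.
  apply: leq_trans (leq_imset_card _ _) _; apply: (bigmax_sup S) => //; apply/andP; split.
    apply/independentP => x y; rewrite !inE => /andP[xS' _] /andP[yS' _].
    by apply/negP => xy; have := indS' _ _ xS' yS'; rewrite pi_edge.
  apply/forallP => i; apply/implyP; rewrite inE => /andP[_ /forallP/(_ i)].
  by rewrite eqxx.
have S0 : independent (finset.set0 : {set G}) &&
    [forall i, (boundary G i \in (finset.set0 : {set G})) ==> (i \in X)].
  by apply/andP; split; [apply/independentP => x y; rewrite inE | apply/forallP => i; rewrite inE].
pose A := [pred S : {set G} | independent S & [forall i, (boundary G i \in S) ==> (i \in X)]].
have A0 : 0 < #|A| by apply/card_gt0P; exists finset.set0.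
have [S /andP[/independentP indS /forallP avS] ES] := eq_bigmax_cond (fun S : {set G} => #|S|) A0.
have -> : restricted_opt G X = #|S| by rewrite -ES; apply: eq_bigl.
pose L : {set glue G tester} := [set pi (inr (true, i)) | i in 'I_t].
pose S' : {set glue G tester} := [set pi (inl x) | x in S] :|: L.
have inlS' x : pi (inl x) \in S' -> x \in S.
  rewrite in_setU => /orP[/imsetP[y yS E]|/imsetP[i _ /esym/pi_leaf]//].
  by rewrite (pi_inl_inj E).
have indS' : independent S'.
  apply/independentP => C D CS' DS'; apply/negP.
  case/existsP=> u /existsP[v /and3P[/eqP uC /eqP vD]]; move: CS' DS'; rewrite -uC -vD.
  case: u v {uC vD} => [x|[b i]] [y|[b' i']] //=.
    by move=> /inlS' xS /inlS' yS xy; have := indS _ _ xS yS; rewrite xy.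
  rewrite /leaf_edge /= => uS vS /and3P[bb /eqP ii iX]; subst i'.
  suff : boundary G i \in S by move=> bS; have := avS i; rewrite bS (negbTE iX).
  by apply: inlS'; rewrite -pi_boundary; case: b b' bb uS vS => [] [].
have -> : #|S| + t = #|S'|.
  rewrite cardsU disjoint_setI0 ?cards0 ?subn0; last first.
    apply/pred0P => w /=; apply/negbTE/negP => /andP[/imsetP[x _ ->] /imsetP[i _ /esym/pi_leaf]] //.
  have injl : injective (fun x : G => pi (inl x)) by move=> x y; exact: pi_inl_inj.
  have injr : injective (fun i => pi (inr (true, i))) by move=> i j /pi_leaf [].
  by rewrite (card_imset _ injl) (card_imset _ injr) card_ord.
exact: (bigmax_sup S').
Qed.

End Tester.

(** The unknown shift [Delta] cancels only when two values of the same graph are compared. *)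
Lemma equiv_restricted_opt (t : nat) (G H : bgraph t) (X Y : {set 'I_t}) : equiv_IS G H ->
  (restricted_opt G X == restricted_opt G Y) = (restricted_opt H X == restricted_opt H Y).
Proof.
move=> [D GH]; have := GH (tester Y); have := GH (tester X).
rewrite !opt_glue_tester; lia.
Qed.

Lemma equiv_IS_refl (t : nat) (G : bgraph t) : equiv_IS G G.
Proof. by exists 0%R => F; rewrite GRing.addr0. Qed.

Lemma restricted_opt_iso (t : nat) (G H : bgraph t) (f : G -> H) (X : {set 'I_t}) :
  bijective f -> (forall x y, sedge (f x) (f y) = sedge x y) ->
  (forall i, f (boundary G i) = boundary H i) -> restricted_opt G X = restricted_opt H X.
Proof.
move=> fbij fe fb; have finj := bij_inj fbij; have [g fK gK] := fbij.
have ge x y : sedge (g x) (g y) = sedge x y by rewrite -fe !gK.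
have gb i : g (boundary H i) = boundary G i by rewrite -fb fK.
have mono (G' H' : bgraph t) (h : G' -> H') (h' : H' -> G') : cancel h h' -> cancel h' h ->
    (forall x y, sedge (h' x) (h' y) = sedge x y) -> (forall i, h' (boundary H' i) = boundary G' i) ->
    restricted_opt G' X <= restricted_opt H' X.
  move=> hK h'K he hb; apply/bigmax_leqP => S /andP[/independentP indS /forallP avS].
  rewrite -(card_imset _ (can_inj hK)); apply: (bigmax_sup (h @: S)) => //; apply/andP; split.
    apply/independentP => _ _ /imsetP[x xS ->] /imsetP[y yS ->].
    by rewrite -he !hK; apply: indS.
  apply/forallP => i; apply/implyP => /imsetP[x xS E]; apply: (implyP (avS i)).
  by rewrite -hb E hK.
by apply/eqP; rewrite eqn_leq (mono _ _ f g) // (mono _ _ g f).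
Qed.

(** * Monotone functions and Dedekind numbers *)

Section Monotone.
Variable t : nat.
Local Notation assignment := {ffun 'I_t -> bool}.
Implicit Types (f : {ffun assignment -> bool}) (X Y : {set 'I_t}) (x y : assignment).

Definition indicator X : assignment := [ffun i => i \in X].
Definition support_set x : {set 'I_t} := [set i | x i].

Lemma support_setK x : indicator (support_set x) = x.
Proof. by apply/ffunP => i; rewrite ffunE inE. Qed.

Lemma indicatorK X : support_set (indicator X) = X.
Proof. by apply/setP => i; rewrite inE ffunE. Qed.

Lemma monotone_bfP f : reflect (forall x y, (forall i, x i -> y i) -> f x -> f y) (monotone_bf f).
Proof.
apply: (iffP idP) => [/forallP H x y xy|H].
  by move/forallP: (H x) => /(_ y)/implyP/(_ _)/implyP; apply; apply/forallP => i; apply/implyP/xy.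
apply/forallP => x; apply/forallP => y; apply/implyP => /forallP xy; apply/implyP; apply: H => i.
exact: implyP (xy i).
Qed.

Section Realization.
Variable f : {ffun assignment -> bool}.
Hypothesis mono_f : monotone_bf f.

Definition falsifiers : seq assignment := enum [pred y | ~~ f y].

(* The clause of a falsifying assignment [y] asks for some variable that is false in [y]. *)
Definition clause_literal (j i : nat) : bool :=
  [exists k : 'I_t, (k == i :> nat) && ~~ nth (indicator set0) falsifiers j.-1 k].

Definition realization : bgraph t := bgrid (size falsifiers) t clause_literal.

Lemma realizationP X : 0 < t ->
  f (indicator X) = (restricted_opt realization X == saturation (size falsifiers) t clause_literal).
Proof.
move=> t0; have [_ sat] := restricted_opt_bgrid (size falsifiers) clause_literal X t0.
apply/idP/idP => [fX|/sat clauses].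
  apply/sat => j /andP[j0 jN]; set y := nth (indicator set0) falsifiers j.-1.
  have : y \in falsifiers by apply: mem_nth; rewrite prednK.
  rewrite mem_enum inE => fy.
  suff /exists_inP[k kX yk] : [exists k in X, ~~ y k].
    by exists k => //; apply/existsP; exists k; rewrite eqxx.
  apply: contraNT fy; rewrite negb_exists_in => /forall_inP yX.
  apply: (monotone_bfP _ mono_f _ _ _ fX) => i; rewrite ffunE => /yX.
  by rewrite negbK.
apply: contraT => fX; have yF : indicator X \in falsifiers by rewrite mem_enum inE.
have [|k kX] := clauses (index (indicator X) falsifiers).+1; first by rewrite index_mem.
case/existsP => k' /andP[/eqP/val_inj ->]; rewrite nth_index // ffunE => /negP[].
exact: kX.
Qed.

(** Truth at the full set makes its optimum equal to the saturation number; if it failed, the full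
    set would contribute an empty clause. *)
Lemma realization_value X : 0 < t -> f (indicator setT) ->
  f (indicator X) = (restricted_opt realization X == restricted_opt realization setT).
Proof.
move=> t0 fT; move: (fT); rewrite (realizationP _ t0) => /eqP ->; exact: realizationP.
Qed.

End Realization.

Lemma dedekind_le : dedekind t <= 2 ^ (2 ^ t).
Proof. by rewrite /dedekind (leq_trans (max_card _)) // !card_ffun !card_bool card_ord. Qed.

(** A function that is 0 below layer [k] and 1 above it is monotone for any choice of its values on
    the layer. *)
Lemma bin_le_dedekind k : 2 ^ 'C(t, k) <= dedekind t.
Proof.
pose L := [set X : {set 'I_t} | #|X| == k].
have -> : 2 ^ 'C(t, k) = #|powerset L|.
  by rewrite card_powerset -[t in LHS]card_ord -card_draws.
pose F (A : {set {set 'I_t}}) : {ffun assignment -> bool} :=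
  [ffun x => (k < #|support_set x|) || (support_set x \in A)].
have FM A : A \in powerset L -> monotone_bf (F A).
  rewrite inE => /subsetP AL; apply/monotone_bfP => x y xy; rewrite !ffunE.
  have xy' : support_set x \subset support_set y.
    by apply/subsetP => i; rewrite !inE; apply: xy.
  case/orP => [kx|xA]; first by rewrite (leq_trans kx) ?subset_leq_card.
  have := AL _ xA; rewrite inE => /eqP xk; case: ltnP => //= yk.
  suff <- : support_set x = support_set y by [].
  by apply/eqP; rewrite eqEcard xy' xk.
have Finj : {in powerset L &, injective F}.
  move=> A B; rewrite !inE => /subsetP AL /subsetP BL /ffunP FAB.
  apply/setP => X; have [XL|XL] := boolP (X \in L).
    have := FAB (indicator X); rewrite !ffunE !indicatorK.
    by move: XL; rewrite inE => /eqP ->; rewrite ltnn.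
  have notin (C : {set {set 'I_t}}) : {subset C <= L} -> (X \in C) = false.
    by move=> CL; apply/negbTE; apply: contra XL; apply: CL.
  by rewrite !notin.
rewrite -(card_in_imset Finj) /dedekind; apply: subset_leq_card.
by apply/subsetP => _ /imsetP[A AL ->]; rewrite inE; apply: FM.
Qed.

Definition nonzero_monotone f : bool := monotone_bf f && f (indicator setT).

Lemma dedekind_nonzero : dedekind t <= #|[pred f | nonzero_monotone f]| + 1.
Proof.
pose zero : {ffun assignment -> bool} := [ffun => false].
have -> : dedekind t = #|[set f : {ffun assignment -> bool} | monotone_bf f]|.
  by apply: eq_card => f; rewrite !inE.
have -> : #|[pred f | nonzero_monotone f]| = #|[set f : {ffun assignment -> bool} | nonzero_monotone f]|.
  by apply: eq_card => f; rewrite !inE.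
rewrite -(cards1 zero); apply: leq_trans (leq_card_setU _ _); apply: subset_leq_card.
apply/subsetP => f; rewrite !inE /nonzero_monotone => mf; rewrite mf /=.
case fT : (f (indicator setT)) => //=; apply/eqP/ffunP => x; rewrite ffunE.
apply/negbTE/negP => fx; move/negP: fT; apply.
by apply: (monotone_bfP _ mf _ _ _ fx) => i; rewrite ffunE inE.
Qed.

End Monotone.

(** The bound of the middle binomial coefficient by 2^t / sqrt(4t), squared to stay in the natural
    numbers. *)
Lemma central_bin t : 0 < t -> 4 ^ t <= 4 * t * 'C(t, t./2) ^ 2.
Proof.
have down k : k.+1 * 'C(k.*2.+1, k) = k.*2.+1 * 'C(k.*2, k).
  by rewrite (mul_bin_down k.*2.+1 k); congr (_ * _); lia.
have step k : k.+1 * 'C(k.+1.*2, k.+1) = 2 * k.*2.+1 * 'C(k.*2, k).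
  have := mul_bin_diag k.*2.+2 k; rewrite doubleS /= => e1.
  apply/eqP; rewrite -(eqn_pmul2l (ltn0Sn k)) -e1; apply/eqP.
  by rewrite mulnCA down -[2 * _ * _]mulnA; set D := _ * 'C(_, _); rewrite -doubleS -mul2n mulnCA mulnA.
(* Stronger by a factor 2 than the claim at t = 2k; the odd case consumes this slack. The induction
   step is (2k + 1)^2 >= 4k(k + 1). *)
have even k : 0 < k -> 16 ^ k <= 4 * k * 'C(k.*2, k) ^ 2.
  case: k => // k _; elim: k => [|k IHk]; first by rewrite bin1.
  have := step k.+1; move: IHk; set a := 'C(k.+1.*2, _); set b := 'C(_, _).
  rewrite (expnS 16 k.+1) -(leq_pmul2l (ltn0Sn k.+1)); set c := 16 ^ k.+1 => IHk E.
  have E2 : (k.+2 * b) ^ 2 = (2 * (k.+1).*2.+1 * a) ^ 2 by rewrite E.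
  rewrite !expnMn in E2; set A := a ^ 2 in IHk E2; set B := b ^ 2 in E2 *.
  nia.
have pow4 k : 4 ^ k.*2 = 16 ^ k by rewrite -mul2n expnM.
move=> t0; have [k tE] : exists k, t = k.*2 \/ t = k.*2.+1.
  by exists t./2; have := odd_double_half t; case: (odd t); lia.
case: tE => tE; subst t.
  rewrite doubleK pow4; apply: leq_trans (even k _) _; first by lia.
  by rewrite leq_mul2r; apply/orP; right; lia.
rewrite (_ : k.*2.+1./2 = k); last by rewrite -(doubleK k) /= uphalf_double.
case: k t0 => [|k] _; first by [].
have := even k.+1 isT; have := down k.+1.
rewrite (expnS 4) pow4.
set a := 'C((k.+1).*2, _); set b := 'C(_, _); set c := 16 ^ k.+1 => E H.
have E2 : (k.+2 * b) ^ 2 = ((k.+1).*2.+1 * a) ^ 2 by rewrite E.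
rewrite !expnMn in E2; set A := a ^ 2 in H E2; set B := b ^ 2 in E2 *.
have K2 : 0 < k.+2 ^ 2 by [].
rewrite -(leq_pmul2l K2).
have -> : k.+2 ^ 2 * (4 * (k.+1).*2.+1 * B) = 4 * (k.+1).*2.+1 * ((k.+1).*2.+1 ^ 2 * A).
  by rewrite -E2; lia.
nia.
Qed.

(** At 16 both sides are equal; this is the origin of the threshold 17. *)
Lemma quartic_lt t : 17 <= t -> t ^ 4 < 2 ^ t.
Proof.
move=> /subnKC <-; elim: (t - 17) => [|d IHd]; first by rewrite addn0; lia.
rewrite addnS; move: IHd; rewrite [2 ^ _.+1]expnS; set s := 17 + d => IHd.
have s17 : 17 <= s by rewrite /s leq_addr.
suff : s.+1 ^ 4 <= 2 * s ^ 4 by lia.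
nia.
Qed.

(** * Plane drawings exclude K5 minors *)

From mathcomp Require Import all_classical all_reals all_analysis.
Import Order.TTheory GRing.Theory Num.Theory numFieldNormedType.Exports.

Local Open Scope ring_scope.

Section Arcs.
Local Open Scope classical_set_scope.
Variable R : realType.
Implicit Types (f g : R -> R * R) (u v w : R * R) (S : set (R * R)).

(** Finite substitute for a path inside [S], on which crossings can be counted. *)
Definition chain (d : R) S u v : Prop :=
  exists s : seq (R * R),
    [/\ path (fun x y => `|x - y| < d) u s, last u s = v & forall z, z \in u :: s -> S z].

Lemma chain_refl d S u : S u -> chain d S u u.
Proof. by move=> Su; exists [::]; split=> // z; rewrite inE => /eqP->. Qed.

Lemma chain_trans d S v u w : chain d S u v -> chain d S v w -> chain d S u w.
Proof.
move=> [s [ps ls Ss]] [s' [ps' ls' Ss']]; exists (s ++ s'); split.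
- by rewrite cat_path ps ls.
- by rewrite last_cat ls.
- move=> z; rewrite -cat_cons mem_cat => /orP[/Ss//|zs'].
  by apply: Ss'; rewrite inE zs' orbT.
Qed.

Lemma chain_step d S u v : S u -> S v -> `|u - v| < d -> chain d S u v.
Proof.
move=> Su Sv uv; exists [:: v]; split=> //=; first by rewrite uv.
by move=> z; rewrite !inE => /orP[]/eqP->.
Qed.

Lemma chain_sym d S u v : chain d S u v -> chain d S v u.
Proof.
move=> [s [ps ls Ss]]; elim: s u ps ls Ss => [|x s IHs] u /=.
  by move=> _ -> Ss; apply: chain_refl; apply: Ss; rewrite mem_head.
move=> /andP[ux ps] ls Ss; apply: (@chain_trans _ _ x).
  by apply: IHs => // z zs; apply: Ss; rewrite inE zs orbT.
by apply: chain_step; rewrite 1?distrC //; apply: Ss; rewrite !inE eqxx ?orbT.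
Qed.

Lemma sub_chain d S S' u v : S `<=` S' -> chain d S u v -> chain d S' u v.
Proof. by move=> SS' [s [ps ls Ss]]; exists s; split=> // z /Ss/SS'. Qed.

Lemma within_dist f s e : {within `[0, 1], continuous f} -> 0 <= s <= 1 -> 0 < e ->
  exists2 d, 0 < d & forall x, 0 <= x <= 1 -> `|x - s| < d -> `|f x - f s| < e.
Proof.
move=> /subspace_continuousP cf s01 e0.
have /cvgrPdist_lt/(_ _ e0) := cf s s01.
rewrite near_withinE /= => /nbhs_ballP[d /= d0 sub]; exists d => // x x01 xs.
rewrite distrC; apply: sub => //=; by rewrite /ball /= distrC.
Qed.

(** The supremum of the parameters reachable from 0 is reachable by continuity, and below 1 it could
    be exceeded. *)
Lemma arc_chain d f : {within `[0, 1], continuous f} -> 0 < d ->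
  chain d (f @` `[0, 1]) (f 0) (f 1).
Proof.
move=> cf d0; set I := f @` _.
have fI x : 0 <= x <= 1 -> I (f x) by move=> x01; exists x.
pose E := [set s | 0 <= s <= 1 /\ chain d I (f 0) (f s)].
have E0 : E 0 by split; [rewrite lexx ler01 | apply: chain_refl; apply: fI; rewrite lexx ler01].
have hE : has_sup E.
  by split; [exists 0 | exists 1 => s [/andP[]]].
set m := sup E.
have m0 : 0 <= m by apply: ub_le_sup => //; case: hE.
have m1 : m <= 1 by apply: ge_sup; [exists 0 | move=> s [/andP[]]].
have m01 : 0 <= m <= 1 by rewrite m0.
have [e e0 He] := within_dist cf m01 d0.
have [s [s01 cs] ms] := sup_adherent e0 hE.
have sm : s <= m by apply: ub_le_sup => //; case: hE.
have cm : chain d I (f 0) (f m).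
  apply: chain_trans cs _; apply: chain_step; [exact: fI | exact: fI | apply: He => //].
  by rewrite distrC ger0_norm ?subr_ge0 // ltrBlDl -ltrBlDr.
have [->|mn1] := eqVneq 1 m; first by [].
pose x := Num.min 1 (m + e / 2).
have mx : m < x.
  by rewrite /x lt_min lt_neqAle eq_sym mn1 m1 ltrDl divr_gt0.
have x01 : 0 <= x <= 1 by rewrite (le_trans m0 (ltW mx)) /x ge_min lexx.
suff /(ub_le_sup (proj2 hE)) : E x by rewrite leNgt mx.
split=> //; apply: chain_trans cm _; apply: chain_step; [exact: fI | exact: fI | rewrite distrC; apply: He => //].
rewrite ger0_norm ?subr_ge0 ?(ltW mx) // ltrBlDl.
have : x <= m + e / 2 by rewrite /x ge_min lexx orbT.
lra.
Qed.

Lemma arcs_far f g : {within `[0, 1], continuous f} -> {within `[0, 1], continuous g} ->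
  (forall s t, 0 <= s <= 1 -> 0 <= t <= 1 -> f s <> g t) ->
  exists2 d, 0 < d & forall s t, 0 <= s <= 1 -> 0 <= t <= 1 -> d <= `|f s - g t|.
Proof.
move=> cf cg fg.
pose K := (f @` `[0, 1]) `*` (g @` `[0, 1]).
have cK : compact K.
  by apply: compact_setX; apply: continuous_compact => //; exact: segment_compact.
have K0 : K !=set0.
  exists (f 0, g 0); split; exists 0 => //=; by rewrite in_itv /= lexx ler01.
have cn : {within K, continuous (fun z : (R * R) * (R * R) => `|z.1 - z.2|)}.
  apply: continuous_subspaceT => z; apply: cvg_norm.
  by apply: cvgB; [exact: cvg_fst | exact: cvg_snd].
have [[z1 z2] /set_mem [/= [s s01 <-] [t t01 <-]] zmin] := compact_EVT_min K0 cK cn.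
exists `|f s - g t|.
  by rewrite normr_gt0 subr_eq0; apply/eqP/fg.
by move=> s' t' s'01 t'01; apply: (zmin (f s', g t')); apply/mem_set; split; [exists s' | exists t'].
Qed.

End Arcs.

(** * Crossing parities of chains *)

Section Parity.
Variable R : realType.
Implicit Types (d : R) (u v w x y : R * R) (s t : seq (R * R)).

(** The positive half-axis is included and the negative one is not, so that exactly one of [w] and
    [- w] is upper when [w] is nonzero. *)
Definition upper w : bool := (0 < w.2) || ((w.2 == 0) && (0 < w.1)).

(* For nearby u and v far from the origin: the step from u to v crosses the positive
   horizontal half-axis. *)
Definition cross u v : bool := (upper u (+) upper v) && (0 < u.1).

Fixpoint crossings y x s : bool :=
  if s is x' :: s' then cross (x - y) (x' - y) (+) crossings y x' s' else false.

Lemma norm_pair_lt u d : (`|u| < d) = (`|u.1| < d) && (`|u.2| < d).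
Proof. by rewrite {1}/Num.norm /= gt_max. Qed.

Lemma upperN w : w != 0 -> upper (- w) = ~~ upper w.
Proof.
case: w => a b; rewrite /upper /= !oppr_gt0 oppr_eq0 => ab0.
case: (ltrgtP b 0) => //= b0; case: (ltrgtP a 0) => //= a0.
by move: ab0; rewrite a0 b0 eqxx.
Qed.

(** The four differences form a small quadrilateral far from the origin, which cannot wind around
    it. Either the second coordinates share a sign and nothing crosses, or the first ones do and
    [cross] is trivial or the telescoping change of [upper]. *)
Lemma cross_square d x x' y y' : `|x - x'| < d -> `|y - y'| < d ->
    4 * d <= `|x - y| -> 4 * d <= `|x' - y| -> 4 * d <= `|x - y'| -> 4 * d <= `|x' - y'| ->
  cross (x - y) (x' - y) (+) cross (x - y') (x' - y') =
  cross (x - y) (x - y') (+) cross (x' - y) (x' - y').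
Proof.
case: x x' y y' => [x1 x2] [x1' x2'] [y1 y2] [y1' y2'].
rewrite !norm_pair_lt /cross /= => /andP[] A1 A2 /andP[] B1 B2 far _ _ _.
move: A1 A2 B1 B2; rewrite !ltr_norml => /andP[? ?] /andP[? ?] /andP[? ?] /andP[? ?].
have [near1|] := lerP `|x1 - y1| (2 * d).
  have far2 : 4 * d <= `|x2 - y2|.
    move: far; rewrite leNgt norm_pair_lt /= negb_and -!leNgt => /orP[far1|//].
    by have := le_trans far1 near1; lra.
  suff up (b : bool) : 0 < (-1) ^+ b * (x2 - y2) - 2 * d ->
      [/\ upper (x1 - y1, x2 - y2) = ~~ b, upper (x1' - y1, x2' - y2) = ~~ b,
          upper (x1 - y1', x2 - y2') = ~~ b & upper (x1' - y1', x2' - y2') = ~~ b].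
    move: far2; rewrite ler_normr => /orP[] H.
      by have [|-> -> -> ->] := up false; [rewrite expr0 mul1r; lra | rewrite addbb].
    by have [|-> -> -> ->] := up true; [rewrite expr1 mulN1r; lra | rewrite addbb].
  rewrite /upper /=; case: b; rewrite ?expr0 ?expr1 ?mulN1r ?mul1r => H.
    by split; apply/negbTE; rewrite negb_or negb_and -leNgt;
       apply/andP; (split; [lra | apply/orP; left; apply/eqP; lra]).
  by split; apply/orP; left; lra.
rewrite lter_normr => /orP[] H.
  have -> : 0 < x1 - y1 by lra.
  have -> : 0 < x1' - y1 by lra.
  have -> : 0 < x1 - y1' by lra.
  rewrite !andbT; do 4 case: (upper _) => //.
have -> : (0 < x1 - y1) = false by apply/negbTE; rewrite -leNgt; lra.
have -> : (0 < x1' - y1) = false by apply/negbTE; rewrite -leNgt; lra.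
have -> : (0 < x1 - y1') = false by apply/negbTE; rewrite -leNgt; lra.
by rewrite !andbF.
Qed.

(** A step that changes half-plane crosses exactly one of the two horizontal half-axes, and negation
    exchanges these. *)
Lemma cross_flip d u v : `|u - v| < d -> 4 * d <= `|u| -> 4 * d <= `|v| ->
  cross u v = cross (- u) (- v) (+) (upper (- u) (+) upper (- v)).
Proof.
move=> uv fu fv.
have d0 : 0 < d by apply: le_lt_trans uv.
have n0 w : 4 * d <= `|w| -> w != 0 by move=> fw; rewrite -normr_gt0; apply: lt_le_trans fw; lra.
rewrite /cross !upperN ?n0 // oppr_gt0.
have -> : (~~ upper u (+) ~~ upper v) = upper u (+) upper v by case: (upper u) (upper v) => [] [].
case E: (upper u (+) upper v) => //=.
suff : u.1 != 0 by case: ltgtP.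
apply: contraTneq E => u1; move: uv fu fv; case: u u1 => a b /= ->; case: v => a' b'.
rewrite norm_pair_lt /= => /andP[_]; rewrite ltr_norml => /andP[A1 A2].
rewrite leNgt norm_pair_lt /= normr0 (_ : 0 < 4 * d) /=; last lra.
rewrite -leNgt ler_normr => H _.
suff -> : upper (0, b) = upper (a', b') by rewrite addbb.
rewrite /upper /=; case/orP: H => H.
  have -> : 0 < b by lra.
  by have -> : 0 < b' by lra.
have -> : (0 < b) = false by apply/negbTE; rewrite -leNgt; lra.
have -> : (0 < b') = false by apply/negbTE; rewrite -leNgt; lra.
have -> : b == 0 = false by apply/negbTE/eqP; lra.
by have -> : b' == 0 = false by apply/negbTE/eqP; lra.
Qed.

Definition nearby d : rel (R * R) := fun x y => `|x - y| < d.

Lemma crossings_strip d x s y y' : path (nearby d) x s -> nearby d y y' ->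
    {in x :: s, forall z, 4 * d <= `|z - y|} -> {in x :: s, forall z, 4 * d <= `|z - y'|} ->
  crossings y x s (+) crossings y' x s =
  cross (x - y) (x - y') (+) cross (last x s - y) (last x s - y').
Proof.
move=> ps yy; elim: s x ps => [|x' s IHs] x /=; first by rewrite addbb.
move=> /andP[xx ps] far far'.
have sub P : {in x :: x' :: s, forall z, P z} -> [/\ P x, P x' & {in x' :: s, forall z, P z}].
  move=> H; split; [apply: H | apply: H | move=> z zs; apply: H]; rewrite !inE ?eqxx ?orbT //.
  by rewrite -in_cons zs orbT.
have [fx fx' fs] := sub _ far; have [fxy fxy' fs'] := sub _ far'.
rewrite addbACA (cross_square xx yy fx fx' fxy fxy') (IHs _ ps fs fs').
by rewrite -addbA addKb.
Qed.

(** Summing [cross_square] over the rectangle of the two chains leaves its four sides. [cross_flip]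
    turns the sides along which [y] moves into crossings of [t] seen from the ends of [s]; the
    [upper] terms telescope. *)
Lemma crossings_pair d x s y t : path (nearby d) x s -> path (nearby d) y t ->
    (forall z w, z \in x :: s -> w \in y :: t -> 4 * d <= `|z - w|) ->
  crossings y x s (+) crossings (last y t) x s =
  (crossings x y t (+) crossings (last x s) y t) (+)
  ((upper (y - x) (+) upper (last y t - x)) (+)
   (upper (y - last x s) (+) upper (last y t - last x s))).
Proof.
move=> ps; elim: t y => [|y' t IHt] y /=.
  by rewrite !addbb.
move=> /andP[yy pt] far.
have far_y' : forall z w, z \in x :: s -> w \in y' :: t -> 4 * d <= `|z - w|.
  by move=> z w zs wt; apply: far => //; rewrite inE wt orbT.
have strip : crossings y x s (+) crossings y' x s =
    cross (x - y) (x - y') (+) cross (last x s - y) (last x s - y').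
  apply: (@crossings_strip d) => // z zs; apply: far; rewrite // !inE eqxx ?orbT //.
have flip z : z \in x :: s -> cross (z - y) (z - y') =
    cross (y - z) (y' - z) (+) (upper (y - z) (+) upper (y' - z)).
  move=> zs; rewrite (@cross_flip d) ?opprB //; last 2 first.
  - by apply: far; rewrite ?mem_head.
  - by apply: far; rewrite // !inE eqxx orbT.
  by rewrite addrC addrA subrK distrC.
move: strip; rewrite !flip ?mem_head ?mem_last //.
move=> /(canRL (addbK _)) ->; rewrite -addbA (IHt _ pt far_y').
have xor g g' c c' a b e a' b' e' : (g (+) (a (+) b) (+) (g' (+) (a' (+) b'))) (+)
    ((c (+) c') (+) ((b (+) e) (+) (b' (+) e'))) =
    ((g (+) c) (+) (g' (+) c')) (+) ((a (+) e) (+) (a' (+) e')).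
  by move: g g' c c' a b e a' b' e'; do 10 case.
exact: xor.
Qed.

(* The fifteen pairs of disjoint edges of K5 give contradictory parities: in the
   sum of [crossings_pair] over them every [crossings] term occurs twice, and the
   [upper] terms of the pairs of two vertices cancel up to an odd number of
   inversions, one for each 4-subset a < b < c < d (from the pair {ac, bd}). *)
Lemma K5_chains (d : R) (v : nat -> R * R) (s : nat -> nat -> seq (R * R)) : 0 < d ->
  (forall i j, (i < j < 5)%N -> path (nearby d) (v i) (s i j) /\ last (v i) (s i j) = v j) ->
  (forall i j k l, (i < j < 5)%N -> (k < l < 5)%N -> uniq [:: i; j; k; l] -> forall z w,
     z \in v i :: s i j -> w \in v k :: s k l -> 4 * d <= `|z - w|) -> False.
Proof.
move=> d0 ps far.
pose A i j k := crossings (v k) (v i) (s i j).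
pose H i j := upper (v j - v i).
have HN i j k l m n : (k < l < 5)%N -> (m < n < 5)%N -> uniq [:: k; l; m; n] ->
    i \in [:: k; l] -> j \in [:: m; n] -> H j i = ~~ H i j.
  move=> kl mn klmn ikl jmn; rewrite /H -opprB upperN // -normr_gt0.
  apply: (@lt_le_trans _ _ (4 * d)); first lra.
  have vm a b c : (b < c < 5)%N -> a \in [:: b; c] -> v a \in v b :: s b c.
    move=> bc; rewrite in_cons mem_seq1 => /orP[]/eqP->; first by rewrite mem_head.
    by have [_ <-] := ps _ _ bc; rewrite mem_last.
  by rewrite distrC (far _ _ _ _ kl mn klmn) ?vm.
have eqn i j k l : (i < j < 5)%N -> (k < l < 5)%N -> uniq [:: i; j; k; l] ->
    xorb (xorb (A i j k) (A i j l)) (xorb (xorb (A k l i) (A k l j))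
      (xorb (xorb (H i k) (H i l)) (xorb (H j k) (H j l)))) = false.
  move=> ij kl ijkl; have [pij lij] := ps _ _ ij; have [pkl lkl] := ps _ _ kl.
  have := crossings_pair pij pkl (fun z w => far _ _ _ _ ij kl ijkl z w); rewrite lij lkl.
  rewrite -!/(A _ _ _) -!/(H _ _) => E.
  (* The sums are phrased with [xorb], the form that [btauto] recognises. *)
  have xE a b : xorb a b = a (+) b by case: a.
  by rewrite !xE E addbb.
have add a b : a = false -> b = false -> xorb a b = false by move=> -> ->.
have := add _ _ (@eqn 0 1 2 3 isT isT isT) (add _ _ (@eqn 0 2 1 3 isT isT isT)
  (add _ _ (@eqn 0 3 1 2 isT isT isT) (add _ _ (@eqn 0 1 2 4 isT isT isT)
  (add _ _ (@eqn 0 2 1 4 isT isT isT) (add _ _ (@eqn 0 4 1 2 isT isT isT)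
  (add _ _ (@eqn 0 1 3 4 isT isT isT) (add _ _ (@eqn 0 3 1 4 isT isT isT)
  (add _ _ (@eqn 0 4 1 3 isT isT isT) (add _ _ (@eqn 0 2 3 4 isT isT isT)
  (add _ _ (@eqn 0 3 2 4 isT isT isT) (add _ _ (@eqn 0 4 2 3 isT isT isT)
  (add _ _ (@eqn 1 2 3 4 isT isT isT) (add _ _ (@eqn 1 3 2 4 isT isT isT)
  (@eqn 1 4 2 3 isT isT isT)))))))))))))).
rewrite (@HN 1 2 0 1 2 3) // (@HN 1 3 0 1 2 3) // (@HN 2 3 0 2 1 3) //.
rewrite (@HN 1 4 0 1 2 4) // (@HN 2 4 0 2 1 4) // (@HN 3 4 0 3 1 4) //.
by move=> E; suff : true = false by []; rewrite -E; btauto.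
Qed.

End Parity.

Section Planar.
Variables (R : realType) (G : sgraph) (p : G -> R * R) (a : {set G} -> R -> R * R).
Hypothesis pa : plane_drawing p a.

Definition trace (W : {set G}) : set (R * R) :=
  [set z | (exists2 x, x \in W & z = p x) \/
           exists2 E : {set G}, (E \in edge_set G) && (E \subset W) & (a E @` `[0, 1])%classic z]%classic.

(** Vertices become constant curves, so that a single separation statement covers vertices and
    edges. Sets that are not edges get a dummy curve, excluded by [valid]. *)
Definition curve (i : G + {set G}) : R -> R * R :=
  match i with
  | inl x => cst (p x)
  | inr E => if E \in edge_set G then a E else cst 0
  end.

Definition support (i : G + {set G}) : {set G} :=
  match i with inl x => [set x]%SET | inr E => E end.

Definition valid (i : G + {set G}) : bool := if i is inr E then E \in edge_set G else true.

Lemma traceP (W : {set G}) z : trace W z -> exists i, [/\ support i \subset W,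
  valid i & exists2 s, 0 <= s <= 1 & z = curve i s].
Proof.
case=> [[x xW ->]|[E /andP[EG EW] [s s01 <-]]].
  exists (inl x); rewrite /= finset.sub1set; split=> //.
  by exists 0; rewrite ?lexx ?ler01.
exists (inr E); split=> //; exists s => //=; by rewrite EG.
Qed.

Lemma edge_setP (E : {set G}) : reflect (exists x y : G, sedge x y /\ E = [set x; y]%SET) (E \in edge_set G).
Proof.
apply: (iffP imsetP) => [[[x y] xy ->]|[x [y [xy ->]]]]; last by exists (x, y); rewrite ?inE.
by exists x, y; split=> //; move: xy; rewrite inE.
Qed.

Lemma curve_disjoint i j s t : [disjoint support i & support j] ->
    valid i ->
    valid j ->
    0 <= s <= 1 -> 0 <= t <= 1 -> curve i s <> curve j t.
Proof.
case: pa => pinj aP ap aa.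
have ends E u : E \in edge_set G -> 0 <= u <= 1 -> ~ (0 < u < 1) ->
    exists2 v, v \in E & a E u = p v.
  move=> EG u01 un; have [_ _ eE] := aP _ EG.
  have : [set a E 0; a E 1]%classic (a E u).
    case/andP: u01; rewrite le_eqVlt => /orP[/eqP<- _|u0]; first by left.
    rewrite le_eqVlt => /orP[/eqP->|u1]; first by right.
    by case: un; rewrite u0.
  by rewrite eE => -[v vE <-]; exists v.
case: i j => [x|E] [y|F] /= dj EG FG s01 t01; rewrite /= ?EG ?FG.
- by move/pinj => xy; move: dj; rewrite xy disjoints1 inE eqxx.
- have [t01'|/(ends _ _ FG t01)[v vF ->]] := pselect (0 < t < 1).
    by move=> /esym; apply: ap.
  by move/pinj => xv; move: dj; rewrite xv disjoints1 vF.
- have [s01'|/(ends _ _ EG s01)[v vF ->]] := pselect (0 < s < 1).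
    exact: ap.
  by move/pinj => xv; move: dj; rewrite -xv disjoint_sym disjoints1 vF.
have EF : E <> F.
  move=> EF; have /edge_setP[x [y [_ Exy]]] := EG.
  by move: dj; rewrite -EF -setI_eq0 finset.setIid Exy => /eqP/setP/(_ x); rewrite !inE eqxx.
have [s01'|/(ends _ _ EG s01)[v vE ->]] := pselect (0 < s < 1); last first.
  have [t01'|/(ends _ _ FG t01)[w wF ->]] := pselect (0 < t < 1).
    by move=> /esym; apply: ap.
  by move/pinj => vw; move/pred0P: dj => /(_ v); rewrite /= vE vw wF.
have [t01'|/(ends _ _ FG t01)[w wF ->]] := pselect (0 < t < 1); last exact: ap.
exact: aa.
Qed.

Lemma curve_continuous i : valid i ->
  {within `[0, 1], continuous (curve i)}%classic.
Proof.
case: i => [x|E] /= EG; first by apply: continuous_subspaceT; exact: cst_continuous.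
by rewrite EG; case: pa => _ aP _ _; case: (aP _ EG).
Qed.

(** Disjoint curves have positive distance by compactness, and there are finitely many pairs of
    curves; irrelevant pairs are given distance 1. *)
Lemma trace_far : exists2 d : R, 0 < d & forall (W W' : {set G}) z z', [disjoint W & W'] ->
  trace W z -> trace W' z' -> 4 * d <= `|z - z'|.
Proof.
have far (ij : (G + {set G}) * (G + {set G})) : exists d : R, 0 < d /\
    (valid ij.1 -> valid ij.2 -> [disjoint support ij.1 & support ij.2] ->
     forall s t, 0 <= s <= 1 -> 0 <= t <= 1 -> d <= `|curve ij.1 s - curve ij.2 t|).
  have [[ok1 ok2 dj]|H] := pselect [/\ valid ij.1, valid ij.2 & [disjoint support ij.1 & support ij.2]].
    have [||s t s01 t01|d d0 Hd] := @arcs_far R (curve ij.1) (curve ij.2).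
    - exact: curve_continuous.
    - exact: curve_continuous.
    - exact: curve_disjoint.
    by exists d.
  by exists 1; split=> // *; case: H.
have [d Hd] := choice far.
pose i0 : (G + {set G}) * (G + {set G}) := (inr finset.set0, inr finset.set0).
case: (arg_minP (P := predT) (i0 := i0) d isT) => i _ imin.
exists (d i / 4); first by have [] := Hd i; lra.
move=> W W' z z' WW' /traceP[j [jW okj [s s01 ->]]] /traceP[k [kW' okk [t t01 ->]]].
rewrite mulrC divfK //; apply: le_trans (imin (j, k) isT) _.
apply: (proj2 (Hd (j, k)) okj okk _ s t s01 t01) => /=.
exact: fintype.disjointW jW kW' WW'.
Qed.

Lemma trace_edge d (W : {set G}) (x y : G) : 0 < d -> x \in W -> y \in W -> sedge x y ->
  chain d (trace W) (p x) (p y).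
Proof.
move=> d0 xW yW xy; have [pinj aP _ _] := pa.
set E := [set x; y]%SET.
have EG : E \in edge_set G by apply/edge_setP; exists x, y.
have EW : E \subset W by apply/fintype.subsetP => z; rewrite !inE => /orP[]/eqP->.
have [cE _ eE] := aP _ EG.
have c : chain d (trace W) (a E 0) (a E 1).
  apply: sub_chain (arc_chain cE d0) => z Ez; right; exists E => //; by rewrite EG.
have : [set a E 0; a E 1]%classic (p x) by rewrite eE; exists x => //=; rewrite /E !inE eqxx.
have : [set a E 0; a E 1]%classic (p y) by rewrite eE; exists y => //=; rewrite /E !inE eqxx orbT.
have xy' : p x <> p y by move/pinj => xy'; move: xy; rewrite xy' sedge_irrefl.
case=> pyE [] pxE; try by case: xy'; rewrite pxE pyE.
  by rewrite pxE pyE; apply: chain_sym.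
by rewrite pxE pyE.
Qed.

Lemma trace_connect d (W B : {set G}) x y : 0 < d -> B \subset W -> x \in B ->
  connect (inside (@sedge G) B) x y -> chain d (trace W) (p x) (p y).
Proof.
move=> d0 /fintype.subsetP BW xB /connectP[s + ->].
elim: s x xB => [|z s IHs] x xB /=.
  by move=> _; apply: chain_refl; left; exists x => //; apply: BW.
move=> /andP[/and3P[_ zB xz] ps]; apply: chain_trans (IHs _ zB ps).
by apply: trace_edge => //; apply: BW.
Qed.

End Planar.

(** The minor itself is never drawn. A vertex is fixed in each branch set, and two of these are
    joined by a chain in the drawing of the union of their branch sets; for disjoint pairs these
    unions are disjoint, so the chains stay far apart. *)
Lemma planar_K5_free (R : realType) (G : sgraph) :
  planar R G -> ~ clique_minor (@sedge G) 5 finset.setT.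
Proof.
move=> [p [a pa]] [b [bP bb]].
have [d d0 far] := trace_far pa.
have [_ /set0Pn[v0 _] _] := bP 0%N isT.
pose u i := odflt v0 [pick x in b i].
have ub i : (i < 5)%N -> u i \in b i.
  move=> i5; have [_ /set0Pn[x xb] _] := bP i i5; rewrite /u; case: pickP => //= /(_ x).
  by rewrite xb.
have chains (ij : nat * nat) : exists s, (ij.1 < ij.2 < 5)%N ->
    [/\ path (nearby d) (p (u ij.1)) s, last (p (u ij.1)) s = p (u ij.2) &
        forall z, z \in p (u ij.1) :: s -> trace p a (b ij.1 :|: b ij.2)%SET z].
  case: ij => i j /=; have [ij|] := boolP (i < j < 5)%N; last by exists [::].
  have /andP[ilj j5] := ij; have i5 := ltn_trans ilj j5.
  have [_ [x [y [xb yb xy]]]] := bb _ _ ij.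
  suff [s Hs] : chain d (trace p a (b i :|: b j)%SET) (p (u i)) (p (u j)) by exists s.
  have [_ _ ci] := bP _ i5; have [_ _ cj] := bP _ j5.
  apply: (@chain_trans _ _ _ (p x)).
    by apply: (trace_connect pa d0 _ (ub _ i5)); [exact: finset.subsetUl | apply: ci => //; exact: ub].
  apply: (@chain_trans _ _ _ (p y)).
    by apply: (trace_edge pa) => //; rewrite inE ?xb ?yb ?orbT.
  by apply: (trace_connect pa d0 _ yb); [exact: finset.subsetUr | apply: cj => //; exact: ub].
have [s Hs] := choice chains.
apply: (@K5_chains R d (fun i => p (u i)) (fun i j => s (i, j)) d0).
  by move=> i j ij; have [] := Hs (i, j) ij.
move=> i j k l ij kl ijkl z w zs wt.
have [_ _ /(_ _ zs) zt] := Hs (i, j) ij; have [_ _ /(_ _ wt) wt'] := Hs (k, l) kl.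
apply: far zt wt' => /=.
have dj m n : (m < 5)%N -> (n < 5)%N -> m != n -> [disjoint b m & b n].
  move=> m5 n5; case: ltngtP => // mn _; first by case: (bb m n); rewrite ?mn.
  by rewrite disjoint_sym; case: (bb n m); rewrite ?mn.
have [/andP[ilj j5] /andP[klk l5]] := (ij, kl).
have [i5 k5] := (ltn_trans ilj j5, ltn_trans klk l5).
move: ijkl; rewrite /= !inE !negb_or -!andbA => /and5P[_ ik il jk /andP[jl _]].
by rewrite -setI_eq0 finset.setIUl !finset.setIUr !finset.setU_eq0 !setI_eq0 !dj.
Qed.

(** * Straight-line drawings on the triangular lattice *)

Section Lattice.
Variable R : realType.

(** Integrality of the common value tells whether the coordinate moves, and its floor gives the
    starting point. *)
Lemma lattice_coord (x x' : nat) (d d' : bool) (s s' : R) : 0 < s < 1 -> 0 < s' < 1 ->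
  x%:R + s * d%:R = x'%:R + s' * d'%:R -> x = x' /\ d = d'.
Proof.
move=> /andP[s0 s1] /andP[s0' s1'].
have between (m n : nat) : (m%:R < n%:R + 1 :> R) -> (m <= n)%N.
  by rewrite -[1]/(1%:R) -natrD addn1 ltr_nat ltnS.
case: d; case: d'; rewrite ?mulr1 ?mulr0 ?addr0 => E.
- by split=> //; apply/eqP; rewrite eqn_leq !between //; lra.
- have le1 : (x' <= x)%N by apply: between; lra.
  have : (x < x')%N by rewrite -(ltr_nat R); lra.
  by rewrite ltnNge le1.
- have le1 : (x <= x')%N by apply: between; lra.
  have : (x' < x)%N by rewrite -(ltr_nat R); lra.
  by rewrite ltnNge le1.
- by move/eqP: E; rewrite eqr_nat => /eqP.
Qed.

Lemma lattice_coord0 (x n : nat) (d : bool) (s : R) : 0 < s < 1 ->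
  x%:R + s * d%:R = n%:R -> d = false.
Proof.
move=> s01 E; have h : 0 < (2^-1 : R) < 1 by apply/andP; split; lra.
by have [] := @lattice_coord x n d false s 2^-1 s01 h; rewrite // mulr0 addr0.
Qed.

(** Edges are drawn as segments in the directions (1,0), (0,1), (1,1), oriented upwards. An interior
    point determines its segment coordinate by coordinate. *)
Lemma planar_lattice (G : sgraph) (z : G -> nat * nat) : injective z ->
  (forall x y, sedge x y -> lattice_step (z x) (z y) || lattice_step (z y) (z x)) -> planar R G.
Proof.
move=> zinj zstep.
have orient (E : {set G}) : exists w : (nat * nat) * (bool * bool), E \in edge_set G ->
    w.2.1 || w.2.2 /\ exists u v, [/\ E = [set u; v]%SET, z u = w.1 &
      z v = (w.1.1 + w.2.1, w.1.2 + w.2.2)%N].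
  have [/edge_setP[x [y [xy ->]]]|_] := boolP (E \in edge_set G); last by exists ((0, 0), (false, false))%N.
  have step (u v : G) : lattice_step (z u) (z v) -> exists d : bool * bool,
      d.1 || d.2 /\ z v = ((z u).1 + d.1, (z u).2 + d.2)%N.
    rewrite /lattice_step !inE => /or3P[]/eqP->; [exists (true, false) | exists (false, true) | exists (true, true)];
    by rewrite ?addn0 ?addn1.
  case/orP: (zstep _ _ xy) => /step[d [d0 dE]].
    by exists (z x, d) => _; split=> //; exists x, y.
  by exists (z y, d) => _; split=> //; exists y, x; rewrite finset.setUC.
have [w wP] := choice orient.
pose p (v : G) : R * R := ((z v).1%:R, (z v).2%:R).
pose a (E : {set G}) (s : R) : R * R :=
  ((w E).1.1%:R + s * (w E).2.1%:R, (w E).1.2%:R + s * (w E).2.2%:R).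
have pinj : injective p.
  move=> u v [] /eqP; rewrite eqr_nat => /eqP uv1 /eqP; rewrite eqr_nat => /eqP uv2.
  by apply: zinj; move: uv1 uv2; case: (z u); case: (z v) => /= ? ? ? ? -> ->.
have affine (x : nat) (d : bool) : continuous (fun s : R => x%:R + s * d%:R : R).
  by move=> s; apply: cvgD; [exact: cvg_cst | apply: cvgM; [exact: cvg_id | exact: cvg_cst]].
exists p, a; split=> //.
- move=> E EG; have [d0 [u [v [EE zu zv]]]] := wP _ EG; split.
  + apply: continuous_subspaceT => s.
    exact: (cvg_pair (affine _ _ s) (affine _ _ s)).
  + move=> s s' _ _ [] /addrI E1 /addrI E2.
    by case/orP: d0 => d1; [move: E1 | move: E2]; rewrite d1 !mulr1.
  have a0 : a E 0 = p u by rewrite /a /p !mul0r !addr0 zu.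
  have a1 : a E 1 = p v by rewrite /a /p !mul1r zv /= !natrD.
  rewrite a0 a1 EE; apply/seteqP; split=> [q [->|->]|q [b bE <-]] /=.
  + by exists u => //=; rewrite !inE eqxx.
  + by exists v => //=; rewrite !inE eqxx orbT.
  + have : b \in [set u; v]%SET by [].
    by rewrite !inE => /orP[]/eqP->; [left | right].
- move=> E s v EG s01 [] /lattice_coord0 d1 /lattice_coord0 d2.
  by have [+ _] := wP _ EG; rewrite d1 // d2.
move=> E E' s s' EG EG' EE' s01 s01' [] /lattice_coord c1 /lattice_coord c2.
have [[x1 d1] [x2 d2]] := (c1 s01 s01', c2 s01 s01').
have [_ [u [v [EE zu zv]]]] := wP _ EG; have [_ [u' [v' [EE2 zu' zv']]]] := wP _ EG'.
apply: EE'; rewrite EE EE2; congr [set _; _]%SET; apply: zinj.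
  by rewrite zu zu'; move: x1 x2; case: ((w E).1); case: ((w E').1) => /= ? ? ? ? -> ->.
by rewrite zv zv' x1 x2 d1 d2.
Qed.

Lemma planar_bgrid (N t : nat) (lit : nat -> nat -> bool) : planar R (bgrid N t lit).
Proof.
apply: (@planar_lattice (bgrid N t lit)
  (fun v : grid_vertex N t => position v.1.1 v.1.2 v.2)).
  by move=> [[j i] b] [[j' i'] b'] /= /position_inj[/val_inj-> /val_inj-> ->].
by move=> u v /orP[] /joins_step; rewrite // orbC.
Qed.

End Lattice.

(** * Counting the classes *)

Local Close Scope ring_scope.

(** [f] is determined by the isomorphism type of the boundaried graph [H f]: m + 1 choices for its
    size, at most (m + 1)^t for the boundary, and the code of the graph. *)
Lemma card_realized (t m : nat) (H : {ffun {ffun 'I_t -> bool} -> bool} -> bgraph t) :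
  (forall f, nonzero_monotone f ->
    [/\ ~ clique_minor (@sedge (H f)) 5 finset.setT, #|H f| <= m &
      forall X, f (indicator X) =
        (restricted_opt (H f) X == restricted_opt (H f) finset.setT)])%N ->
  (#|[pred f : {ffun {ffun 'I_t -> bool} -> bool} | nonzero_monotone f]| <= m.+1 ^ t.+1 * 2 ^ (38 * 522 * m))%N.
Proof.
move=> HP.
pose A (n : nat) := [set f : {ffun {ffun 'I_t -> bool} -> bool} | nonzero_monotone f & #|H f| == n]%SET.
have cA n : (n <= m)%N -> (#|A n| <= m.+1 ^ t * 2 ^ (38 * 522 * m))%N.
  move=> nm; have [I [g [cI Hg]]] := K5_free_codes n.
  have [->|/set0Pn[f0 f0A]] := eqVneq (A n) finset.set0; first by rewrite finset.cards0.
  have code f : f \in A n -> exists c : I * {ffun 'I_t -> 'I_n}, exists h : H f -> 'I_n,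
      [/\ injective h, forall x y, sedge x y = g c.1 (h x) (h y) & forall k, c.2 k = h (boundary (H f) k)].
    rewrite inE => /andP[/HP[free _ _] /eqP fn].
    have [i [h [hinj hg]]] := Hg _ _ (@sedge_sym (H f)) (@sedge_irrefl (H f)) free fn.
    by exists (i, [ffun k => h (boundary (H f) k)]), h; split=> // k; rewrite ffunE.
  have [c0 _] := code f0 f0A.
  have code' f : exists c : I * {ffun 'I_t -> 'I_n}, f \in A n -> exists h : H f -> 'I_n,
      [/\ injective h, forall x y, sedge x y = g c.1 (h x) (h y) & forall k, c.2 k = h (boundary (H f) k)].
    by have [/code[c ?]|_] := boolP (f \in A n); [exists c | exists c0].
  have [c cP] := choice code'.
  have cinj : {in A n &, injective c}.
    move=> f f' fA f'A cc; have [h [hinj hg hb]] := cP f fA; have [h' [hinj' hg' hb']] := cP f' f'A.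
    move: (fA) (f'A); rewrite !inE => /andP[nf /eqP fn] /andP[nf' /eqP fn'].
    have [_ _ fv] := HP f nf; have [_ _ fv'] := HP f' nf'.
    have hbij : bijective h by apply: inj_card_bij => //; rewrite card_ord fn.
    have [k h'k kh'] : bijective h' by apply: inj_card_bij => //; rewrite card_ord fn'.
    have iso X : restricted_opt (H f) X = restricted_opt (H f') X.
      apply: (@restricted_opt_iso _ _ _ (k \o h)).
      - by apply: bij_comp => //; exists h'.
      - by move=> x y /=; rewrite hg' hg !kh' cc.
      - by move=> b /=; rewrite -hb cc hb' h'k.
    by apply/ffunP => x; rewrite -(support_setK x) fv fv' !iso.
  rewrite -(card_in_imset cinj); apply: leq_trans (max_card _) _.
  rewrite card_prod card_ffun !card_ord mulnC; apply: leq_mul.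
    by case: (t) => // t'; rewrite leq_exp2r // leqW.
  by apply: leq_trans cI _; rewrite leq_exp2l // leq_mul2l nm orbT.
rewrite -sum1_card (partition_big (fun f => inord #|H f| : 'I_m.+1) predT) //=.
rewrite expnS -mulnA -[X in (_ <= X * _)%N]card_ord -sum_nat_const; apply: leq_sum => n _.
have := cA n (ltn_ord n); apply: leq_trans; rewrite -sum1_card; apply: eq_leq; apply: eq_bigl => f.
rewrite !inE; apply: andb_id2l => /HP[_ fm _].
by rewrite -val_eqE /= inordK.
Qed.

Local Open Scope ring_scope.

Section Log2.
Variable R : realType.

Lemma log2_exp k : log2 ((2 ^ k)%N%:R) = k%:R :> R.
Proof.
have ln2 : 0 < ln (2 : R) by apply: ln_gt0; lra.
by rewrite /log2 natrX lnXn ?ltr0n // -[ln _ *+ _]mulr_natl mulfK ?gt_eqF.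
Qed.

Lemma ler_log2 (m n : nat) : (0 < m)%N -> (m <= n)%N -> log2 m%:R <= log2 (n%:R : R).
Proof.
move=> m0 mn; have ln2 : 0 < ln (2 : R) by apply: ln_gt0; lra.
by rewrite /log2 ler_pM2r ?invr_gt0 // ler_ln ?posrE ?ltr0n ?ler_nat // (leq_trans m0).
Qed.

End Log2.

(** A coefficient of at most t^3 would give t^8 < 4^t <= 4 t^7. *)
Lemma bin_bound (t : nat) : (17 <= t)%N -> (2 * t.+1 ^ 2 + 2 < 'C(t, t./2))%N.
Proof.
move=> t17; rewrite ltnNge; apply/negP => small.
have q := quartic_lt t17; have c := central_bin (ltn_trans (isT : 0 < 16)%N t17).
have small3 : ('C(t, t./2) <= t ^ 3)%N by apply: leq_trans small _; rewrite !expnS expn0 !muln1; nia.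
have sq : ('C(t, t./2) ^ 2 <= (t ^ 3) ^ 2)%N by rewrite leq_exp2r.
have q2 : ((t ^ 4) ^ 2 < 4 ^ t)%N.
  by rewrite (_ : 4 ^ t = (2 ^ t) ^ 2)%N; [rewrite ltn_exp2r | rewrite -expnM mulnC expnM].
have : ((t ^ 4) ^ 2 < 4 * t * (t ^ 3) ^ 2)%N.
  by apply: leq_trans q2 _; apply: leq_trans c _; rewrite leq_mul2l sq orbT.
rewrite -!expnM -mulnA -expnS ltnNge => /negP[].
by rewrite [(t ^ (4 * 2))%N]expnS leq_mul2r; apply/orP; right; apply: leq_trans t17.
Qed.

Theorem theorem27 (R : realType) :
  exists (c : nat) (alpha : R) (t0 : nat),
    0 < alpha /\
    forall t : nat, (t0 <= t)%N ->
      (forall Rt : bgraph t -> Prop,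
        (forall G, Rt G -> planar R G) ->
        (forall X : bgraph t,
          (exists G, [/\ equiv_IS X G, planar R G & (pathwidth G <= t + c)%N]) ->
          exists2 H, equiv_IS X H & Rt H) ->
        exists2 G, Rt G & alpha * log2 (dedekind t)%:R <= #|G|%:R) /\
      2 ^+ t / Num.sqrt (4 * t%:R) <= log2 (dedekind t)%:R :> R.
Proof.
(* An opaque name keeps the product from being computed. *)
have [K KE] : exists K, K = (38 * 522)%N by eexists.
have K0 : 0 < K%:R :> R by rewrite KE ltr0n.
(* With this factor the codes of graphs below the bound use at most half of the log2 M(t) bits. *)
exists 31%N, ((2 * K%:R)^-1 : R), 17%N; split; first by rewrite invr_gt0 mulr_gt0.
move=> t t17; have t0 : (0 < t)%N by apply: leq_trans t17.
set D := dedekind t; set L := log2 _.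
have binL : 'C(t, t./2)%:R <= L :> R.
  by rewrite -log2_exp; apply: ler_log2; rewrite ?expn_gt0 ?bin_le_dedekind.
split; last first.
  apply: le_trans binL; rewrite ler_pdivrMr ?sqrtr_gt0 ?mulr_gt0 ?ltr0n //.
  rewrite -(@ler_pXn2r _ 2) ?nnegrE ?exprn_ge0 ?mulr_ge0 ?sqrtr_ge0 ?ler0n //.
  rewrite exprMn sqr_sqrtr ?mulr_ge0 ?ler0n // -exprM mulnC exprM.
  have := central_bin t0; rewrite -(ler_nat R) !natrM !natrX => c.
  by rewrite -[2 ^+ 2]natrX [X in _ <= X]mulrC.
move=> Rt planarRt reprRt; apply: contrapT => none.
have small G : Rt G -> #|G|%:R < (2 * K%:R)^-1 * L.
  by move=> RG; rewrite ltNge; apply/negP => big; apply: none; exists G.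
pose m := Num.truncn ((2 * K%:R)^-1 * L).
have L0 : 0 <= L by apply: le_trans binL; rewrite ler0n.
have aL0 : 0 <= (2 * K%:R)^-1 * L by rewrite mulr_ge0 // invr_ge0 mulr_ge0 // ltW.
have /andP[mL Lm] := truncn_itv aL0; rewrite -/m in mL Lm.
have sizem G : Rt G -> (#|G| <= m)%N.
  by move=> /small H; rewrite -ltnS -(ltr_nat R); apply: lt_trans Lm.
have LE : L <= (2 ^ t)%:R.
  rewrite -[X in _ <= X]log2_exp; apply: ler_log2; last exact: dedekind_le.
  by apply: leq_trans (bin_le_dedekind t 0); rewrite expn_gt0.
have KmL : K%:R * m%:R <= L / 2.
  have -> : L / 2 = K%:R * ((2 * K%:R)^-1 * L) by field; rewrite gt_eqF.
  by rewrite ler_pM2l.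
(* Bounds the factor for size and boundary by 2^((t+1)^2). *)
have m2t : (m.+1 <= 2 ^ t.+1)%N.
  have mt : (m <= 2 ^ t)%N.
    rewrite -(ler_nat R); apply: le_trans LE.
    have : m%:R <= K%:R * m%:R :> R by rewrite ler_peMl ?ler0n // ler1n -(ltr0n R).
    lra.
  by rewrite expnS mul2n -addnn -addn1 leq_add // expn_gt0.
have realize (f : {ffun {ffun 'I_t -> bool} -> bool}) :
    exists H, equiv_IS (realization f) H /\ Rt H.
  have [|H eH RH] := reprRt (realization f); last by exists H.
  exists (realization f); split; [exact: equiv_IS_refl | exact: planar_bgrid | exact: pathwidth_grid].
have [H HP] := choice realize.
have count : (#|[pred f : {ffun {ffun 'I_t -> bool} -> bool} | nonzero_monotone f]| <=
    m.+1 ^ t.+1 * 2 ^ (K * m))%N.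
  rewrite KE; apply: (@card_realized t m H) => f /andP[mf fT]; have [eqH RH] := HP f; split.
  - exact/planar_K5_free/planarRt.
  - exact: sizem.
  - by move=> X; rewrite (realization_value mf X t0 fT); apply: equiv_restricted_opt.
have DL : (D <= 2 ^ (t.+1 * t.+1 + K * m + 1))%N.
  apply: leq_trans (dedekind_nonzero t) _; rewrite addn1 expnD expn1 muln2 -addnn.
  have le2 : (m.+1 ^ t.+1 * 2 ^ (K * m) <= 2 ^ (t.+1 * t.+1 + K * m))%N.
    rewrite expnD leq_mul2r; apply/orP; right.
    by rewrite expnM leq_exp2r.
  have := expn_gt0 2 (t.+1 * t.+1 + K * m); move: (leq_trans count le2).
  lia.
have : L <= (t.+1 * t.+1 + K * m + 1)%:R.
  rewrite -[X in _ <= X]log2_exp; apply: ler_log2 => //.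
  by apply: leq_trans (bin_le_dedekind t 0); rewrite expn_gt0.
have := bin_bound t17; rewrite -(ltr_nat R) natrD natrM natrX => small_bin.
rewrite !natrD !natrM => le_L.
(* Here a = (t + 1)^2, b = K m, c is the middle binomial coefficient and l = log2 M(t): halving
   gives l <= 2 a + 2 < c <= l. *)
have absurd (a b c l : R) : 2 * a + 2 < c -> l <= a + b + 1 -> b <= l / 2 -> c <= l -> False.
  by clear=> *; lra.
by apply: absurd le_L KmL binL; rewrite -expr2.
Qed.
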